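(* Let $x,y,z_1,z_2$ be indeterminates, and take $Z_0(x,y)=1$. For every integer $n\ge 2$, the adjacent-boundary doubly-refined ASM generating functions satisfy the recursion relations $$\begin{aligned} &(z_1-1)(z_2-1)\,Z^{\mathrm{adj}}_n(x,y;z_1,z_2)\,Z_{n-2}(x,y)=yz_1z_2\,Z^{\mathrm{adj}}_{n-1}(x,y;z_1,z_2)\,Z_{n-1}(x,y)\\ &\quad+\bigl(x(z_1-1)(z_2-1)-y\bigr)\,z_1z_2\,Z_{n-1}(x,y;z_1)\,Z_{n-1}(x,y;z_2)\\ &\quad+(z_1-1)(z_2-1)\,Z_{n-1}(x,y)\,Z_{n-2}(x,y) \end{aligned}$$ and $$\begin{aligned} &(z_1-1)(z_2-1)\,\widetilde{Z}^{\mathrm{adj}}_n(x,y;z_1,z_2)\,Z_{n-2}(x,y)=yz_1z_2\,\widetilde{Z}^{\mathrm{adj}}_{n-1}(x,y;z_1,z_2)\,Z_{n-1}(x,y)\\ &\quad+\bigl((z_1-1)(z_2-1)-yz_1z_2\bigr)\,Z_{n-1}(x,y;z_1)\,Z_{n-1}(x,y;z_2)\\ &\quad+(z_1-1)(z_2-1)\,(xz_1z_2)^{n-1}\,Z_{n-1}(x,y)\,Z_{n-2}(x,y). \end{aligned}$$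
   Context: An alternating sign matrix (ASM) is a square matrix with entries in $\{0,1,-1\}$ such that along each row and each column the nonzero entries alternate in sign and sum to $1$. $\mathrm{ASM}(n)$ is the set of $n\times n$ ASMs. The first and last rows and columns of an ASM each contain exactly one $1$, all other entries there being $0$. For $A\in\mathrm{ASM}(n)$ define: $\nu(A)=\sum_{1\le i<i'\le n,\;1\le j'\le j\le n}A_{ij}A_{i'j'}$ (a nonnegative integer); $\mu(A)=$ number of $-1$'s in $A$; $\rho_{\mathrm T}(A)=$ number of $0$'s to the left of the $1$ in the top row; $\rho_{\mathrm R}(A)=$ number of $0$'s below the $1$ in the right-most column; $\rho_{\mathrm L}(A)=$ number of $0$'s above the $1$ in the left-most column. Generating functions (for $n\ge1$): $Z^{\mathrm{adj}}_n(x,y;z_1,z_2)=\sum_{A\in\mathrm{ASM}(n)}x^{\nu(A)}y^{\mu(A)}z_1^{\rho_{\mathrm T}(A)}z_2^{\rho_{\mathrm L}(A)}$; $\widetilde{Z}^{\mathrm{adj}}_n(x,y;z_1,z_2)=\sum_{A\in\mathrm{ASM}(n)}x^{\nu(A)}y^{\mu(A)}z_1^{\rho_{\mathrm T}(A)}z_2^{\rho_{\mathrm R}(A)}$; $Z_n(x,y;z)=\sum_{A\in\mathrm{ASM}(n)}x^{\nu(A)}y^{\mu(A)}z^{\rho_{\mathrm T}(A)}$; $Z_n(x,y)=\sum_{A\in\mathrm{ASM}(n)}x^{\nu(A)}y^{\mu(A)}$. *)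

(* Defs.v *)
From mathcomp Require Import all_boot all_order all_algebra.
From mathcomp Require Import mpoly.

Set Implicit Arguments.
Unset Strict Implicit.
Unset Printing Implicit Defensive.

Import Order.TTheory GRing.Theory Num.Theory.
Local Open Scope ring_scope.

(* The entries 0, 1, -1 as a finite subtype of int, so that matrices over it
   form a finType; [asm_mx] reads such a matrix as an integer matrix. *)
Notation asm_entry := (seq_sub [:: 0; 1; -1 : int]).

Definition asm_mx (n : nat) (A : 'M[asm_entry]_n) : 'M[int]_n := map_mx val A.

Definition alternating_sum1 (s : seq int) : bool :=
  sorted [rel a b | a * b < 0] [seq a <- s | a != 0] && (\sum_(a <- s) a == 1).

Definition ASM (n : nat) : {set 'M[asm_entry]_n} :=
  [set A | [forall i, alternating_sum1 [seq asm_mx A i j | j <- enum 'I_n]]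
        && [forall j, alternating_sum1 [seq asm_mx A i j | i <- enum 'I_n]]].

Section Statistics.
Variable n : nat.
Implicit Type A : 'M[asm_entry]_n.

Definition nu A : int :=
  \sum_(i < n) \sum_(i' < n | (i < i')%N)
    \sum_(j < n) \sum_(j' < n | (j' <= j)%N) asm_mx A i j * asm_mx A i' j'.

Definition mu A : nat := #|[set p : 'I_n * 'I_n | asm_mx A p.1 p.2 == -1]|.

(* In the three boundary statistics, the existentially bound indices locate the
   boundary line in question and the position of the 1 in it. *)
Definition rhoT A : nat :=
  #|[set j : 'I_n | [exists t : 'I_n, exists k : 'I_n,
      [&& val t == 0%N, asm_mx A t k == 1, (j < k)%N & asm_mx A t j == 0]]]|.

Definition rhoR A : nat :=
  #|[set i : 'I_n | [exists r : 'I_n, exists k : 'I_n,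
      [&& (val r).+1 == n, asm_mx A k r == 1, (k < i)%N & asm_mx A i r == 0]]]|.

Definition rhoL A : nat :=
  #|[set i : 'I_n | [exists l : 'I_n, exists k : 'I_n,
      [&& val l == 0%N, asm_mx A k l == 1, (i < k)%N & asm_mx A i l == 0]]]|.

End Statistics.

(* The exponent of x is the absolute value `|nu A|, a natural number; it is
   nu A itself because nu A >= 0 on ASM n (lemma nu_ge0 below). *)
Section GeneratingFunctions.
Variables (R : comNzRingType) (n : nat).
Implicit Types x y z : R.

Definition Zadj x y z1 z2 : R :=
  \sum_(A in ASM n) x ^+ `|nu A|%N * y ^+ mu A * z1 ^+ rhoT A * z2 ^+ rhoL A.

Definition Zadj_tilde x y z1 z2 : R :=
  \sum_(A in ASM n) x ^+ `|nu A|%N * y ^+ mu A * z1 ^+ rhoT A * z2 ^+ rhoR A.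

Definition Zrefined x y z : R :=
  \sum_(A in ASM n) x ^+ `|nu A|%N * y ^+ mu A * z ^+ rhoT A.

Definition Zasm x y : R := \sum_(A in ASM n) x ^+ `|nu A|%N * y ^+ mu A.

End GeneratingFunctions.

Arguments Zadj {R} n x y z1 z2.
Arguments Zadj_tilde {R} n x y z1 z2.
Arguments Zrefined {R} n x y z.
Arguments Zasm {R} n x y.

Lemma asm_mx_entry n (A : 'M[asm_entry]_n) i j :
  asm_mx A i j \in [:: 0; 1; -1 : int].
Proof. by rewrite mxE; apply: valP. Qed.

Lemma sum_alternating (a : int) (t : seq int) :
  all (mem [:: 1; -1 : int]) (a :: t) -> path [rel b c | b * c < 0] a t ->
  \sum_(b <- a :: t) b = if last a t == a then a else 0.
Proof.
elim: t a => [|b t IH] a; first by rewrite big_seq1 eqxx.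
move=> /= /and3P[a1 b1 t1] /andP[ab bt].
rewrite big_cons IH //=; last by rewrite b1.
have : last b t \in [:: 1; -1 : int].
  by have /allP/(_ _ (mem_last b t)) : all (mem [:: 1; -1 : int]) (b :: t)
    by rewrite /= b1.
by move: a1 b1 ab; rewrite !inE => /orP[]/eqP-> /orP[]/eqP-> //= _
  /orP[]/eqP->.
Qed.

Lemma suffix_sum_ge0 (s : seq int) (k : nat) :
  all (mem [:: 0; 1; -1 : int]) s -> alternating_sum1 s ->
  0 <= \sum_(a <- drop k s) a.
Proof.
move=> s01 /andP[].
have nz u : \sum_(a <- u) a = \sum_(a <- [seq a : int <- u | a != 0]) a.
  rewrite big_filter [RHS]big_mkcond; apply: eq_bigr => a _.
  by case: eqP.
have : all (mem [:: 1; -1 : int]) [seq a <- s | a != 0].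
  apply/allP => a; rewrite mem_filter => /andP[a0 /(allP s01)].
  by rewrite !inE (negPf a0).
rewrite (nz s) (nz (drop k s)) -{1 2 3}(cat_take_drop k s) filter_cat.
move: [seq a <- take k s | _] [seq a <- drop k s | _] => p [|b q].
  by rewrite big_nil.
rewrite all_cat => /andP[p1 q1] alt_pq.
have alt_q : path [rel b c | b * c < 0] b q.
  by case: p alt_pq {p1} => //= a p; rewrite cat_path => /andP[_ /andP[]].
rewrite (sum_alternating q1 alt_q) => /eqP sum1.
suff -> : last b q = 1 by case: eqP => // <-.
case: p p1 alt_pq sum1 => [_ _|a p p1 alt_pq].
  by rewrite sum_alternating //; case: eqP => // ->.
rewrite sum_alternating //; last by move: p1 => /= /andP[-> p1]; rewrite all_cat p1.
by rewrite last_cat /=; case: eqP => // ->.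
Qed.

Lemma suffix_sum_ordE n (f : 'I_n -> int) (k : nat) :
  \sum_(j < n | (k <= j)%N) f j = \sum_(a <- drop k [seq f j | j <- enum 'I_n]) a.
Proof.
rewrite -map_drop big_map.
have drop_iota0 : drop k (iota 0 n) = [seq i <- iota 0 n | (k <= i)%N].
  have filter0 m : (m <= k)%N -> [seq i <- iota 0 m | (k <= i)%N] = [::].
    move=> mk; apply/eqP; rewrite -[_ == _]negbK -has_filter -all_predC.
    apply/allP => i; rewrite mem_iota /= -ltnNge => im.
    exact: leq_trans im mk.
  case: (leqP k n) => [kn|/ltnW nk]; last first.
    by rewrite filter0 // drop_oversize // size_iota.
  rewrite -(subnKC kn) iotaD filter_cat filter0 // drop_size_cat ?size_iota //.
  apply/esym/all_filterP/allP => i.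
  by rewrite mem_iota => /andP[].
have -> : drop k (enum 'I_n) = [seq j : 'I_n <- enum 'I_n | (k <= j)%N].
  apply: (inj_map val_inj).
  by rewrite map_drop val_enum_ord drop_iota0 -val_enum_ord filter_map.
by rewrite big_filter big_enum_cond.
Qed.

Lemma nu_ge0 n (A : 'M[asm_entry]_n) : A \in ASM n -> 0 <= nu A.
Proof.
rewrite inE => /andP[/forallP row_alt /forallP col_alt].
have -> : nu A = \sum_(i < n) \sum_(j' < n)
    (\sum_(j < n | (j' <= j)%N) asm_mx A i j)
  * (\sum_(i' < n | (i.+1 <= i')%N) asm_mx A i' j').
  apply: eq_bigr => i _.
  under [RHS]eq_bigr => j' _ do rewrite mulr_sumr.
  rewrite [RHS]exchange_big; apply: eq_bigr => i' _ /=.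
  under [RHS]eq_bigr => j' _ do rewrite mulr_suml.
  by rewrite [RHS](exchange_big_dep xpredT).
apply: sumr_ge0 => i _; apply: sumr_ge0 => j' _.
by apply: mulr_ge0; rewrite suffix_sum_ordE; apply: suffix_sum_ge0 => //;
  apply/allP => _ /mapP[k _ ->]; apply: asm_mx_entry.
Qed.

Lemma Zasm0 (R : comNzRingType) (x y : R) : Zasm 0 x y = 1.
Proof.
have A0 : ASM 0 = [set \matrix_(i, j) SeqSub (mem_head 0 [:: 1; -1 : int])].
  apply/setP => A; rewrite !inE; apply/andP/eqP => [_|_].
    by apply/matrixP => -[].
  by split; apply/forallP => -[].
rewrite /Zasm A0 big_set1 /nu /mu big_ord0 absz0 expr0 mul1r.
suff -> : #|[set p : 'I_0 * 'I_0 | asm_mx (\matrix_(i, j)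
  SeqSub (mem_head 0 [:: 1; -1 : int])) p.1 p.2 == -1]| = 0%N by [].
by apply: eq_card0 => -[[]].
Qed.

(* Main.v *)
Require Import Defs.
From mathcomp Require Import all_boot all_order all_algebra.
From mathcomp Require Import mpoly.
From mathcomp Require Import ring fraction algC.

Set Implicit Arguments.
Unset Strict Implicit.
Unset Printing Implicit Defensive.

Import Order.TTheory GRing.Theory Num.Theory.
Local Open Scope ring_scope.

(** Reading partial row and column sums as bits turns alternating sign matrices
    into states of the six-vertex model with domain-wall boundary, and the
    statistics into products of local weights; boundary refinements amount to
    changing the spectral parameter of the first row and of one outer column.
    By the Yang-Baxter equation the partition function Z is symmetric in the
    column parameters, and Lagrange interpolation in the first row parameter
    gives the Izergin-Korepin formula, expressing Z through det(1 / g(u_i, v_j))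
    with g(u, v) = (u - v) (p u - v).  The Desnanot-Jacobi identity for this
    determinant becomes, after clearing denominators,

      (u_2 - u_1) (v_1 - v_2) Z(u; v) Z(u without 1,2; v without 1,2)
        = g(u_1, v_2) g(u_2, v_1) Z(u without 1; v without 1)
                                  Z(u without 2; v without 2)
          - g(u_1, v_1) g(u_2, v_2) Z(u without 1; v without 2)
                                    Z(u without 2; v without 1),

    a polynomial identity, so it survives u_2 = ... = u_n and v_2 = ... = v_n.
    Matrices with their 1 in the corner common to the two special lines must be
    separated since the special corner weight does not factor; this accounts for
    the inhomogeneous terms.  The two recursions correspond to the special column
    standing first or last. *)

(** * Sums over words *)

Section Words.
Variable T : Type.

Fixpoint words (s : seq T) (n : nat) : seq (seq T) :=
  if n is n'.+1 then [seq a :: w | a <- s, w <- words s n'] else [:: [::]].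

Lemma big_words0 (R : nmodType) (s : seq T) (F : seq T -> R) :
  \sum_(w <- words s 0) F w = F [::].
Proof. exact: big_seq1. Qed.

Lemma big_wordsS (R : nmodType) (s : seq T) n (F : seq T -> R) :
  \sum_(w <- words s n.+1) F w
    = \sum_(a <- s) \sum_(w <- words s n) F (a :: w).
Proof. exact: big_allpairs_dep. Qed.

End Words.

Lemma mem_words (T : eqType) (s : seq T) n w :
  (w \in words s n) = (size w == n) && all (mem s) w.
Proof.
elim: n w => [|n IH] [|a w] //=.
  by apply/negbTE/negP => /allpairsP[[? ?] []].
rewrite eqSS andbCA -IH; apply/allpairsP/andP => [[[b t] [? ? [-> ->]]] //|].
by case=> sa wn; exists (a, w).
Qed.

Lemma uniq_words (T : eqType) (s : seq T) n : uniq s -> uniq (words s n).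
Proof.
move=> us; elim: n => //= n IH; rewrite allpairs_uniq //.
by case=> a1 w1 [a2 w2] _ _ [-> ->].
Qed.

Definition bits : nat -> seq (seq bool) := words [:: false; true].

Lemma big_bits0 (R : nmodType) (F : seq bool -> R) :
  \sum_(g <- bits 0) F g = F [::].
Proof. exact: big_seq1. Qed.

Lemma big_bitsS (R : nmodType) n (F : seq bool -> R) :
  \sum_(g <- bits n.+1) F g
    = \sum_(g <- bits n) F (false :: g) + \sum_(g <- bits n) F (true :: g).
Proof. by rewrite /bits big_wordsS big_cons big_seq1. Qed.

(** * The six-vertex model with domain-wall boundary *)

Section Transfer.
Variables (R : comNzRingType) (U V : Type) (a0 a1 b d : U -> V -> R).

(* The vertical bit [k] (resp. horizontal bit [h]) entering a vertex is the sum
   of the entries above it (resp. to its left); [k'] and [h'] leave it.  A zero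
   entry has weight [a0], [a1] or [b], an entry -1 weight [d], and an entry 1
   weight 1. *)
Definition vertex_wt (u : U) (v : V) (k h k' h' : bool) : R :=
  match k, h, k', h' with
  | false, false, false, false => a0 u v
  | true, true, true, true => a1 u v
  | false, true, false, true | true, false, true, false => b u v
  | false, false, true, true => 1
  | true, true, false, false => d u v
  | _, _, _, _ => 0
  end.

Fixpoint column_wt (v : V) (us : seq U) (k k' : bool) (h h' : seq bool) : R :=
  match us, h, h' with
  | [::], [::], [::] => (k == k')%:R
  | u :: us, x :: h, x' :: h' =>
      vertex_wt u v k x false x' * column_wt v us false k' h h'
      + vertex_wt u v k x true x' * column_wt v us true k' h h'
  | _, _, _ => 0
  end.

(* Rows are indexed by [us], columns by [vs]; [h] is the vector of bits entering
   the leftmost remaining column, and all bits leaving the last one are 1. *)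
Fixpoint Zstate (us : seq U) (vs : seq V) (h : seq bool) : R :=
  if vs is v :: vs then
    \sum_(g <- bits (size us)) column_wt v us false true h g * Zstate us vs g
  else (h == nseq (size us) true)%:R.

Definition Zdw us vs := Zstate us vs (nseq (size us) false).

(** No vertical bit enters the top row from above, so a horizontal bit 1 there can only run straight
    to the right. *)
Lemma Zstate_cons_true u us vs h :
  Zstate (u :: us) vs (true :: h) = (\prod_(v <- vs) b u v) * Zstate us vs h.
Proof.
elim: vs h => [|v vs IH] h /=; first by rewrite big_nil mul1r eqseq_cons.
rewrite big_bitsS /= big_cons [X in X + _]big1 ?add0r => [|g _]; last first.
  by rewrite !mul0r addr0 mul0r.
rewrite mulr_sumr; apply: eq_bigr => g _.
by rewrite IH mul0r addr0; ring.
Qed.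

(** The corner holds either a 0, of weight [a0], or the 1 of the top row, which freezes the rest of
    that row. *)
Lemma Zstate_cons_false u us v vs h :
  Zstate (u :: us) (v :: vs) (false :: h)
    = a0 u v * (\sum_(g <- bits (size us))
                   column_wt v us false true h g * Zstate (u :: us) vs (false :: g))
      + (\prod_(w <- vs) b u w)
        * (\sum_(g <- bits (size us)) column_wt v us true true h g * Zstate us vs g).
Proof.
rewrite /= big_bitsS /= !mulr_sumr; congr (_ + _); apply: eq_bigr => g _.
  by rewrite mul0r addr0 mulrA.
by rewrite mul0r add0r mul1r Zstate_cons_true; ring.
Qed.

(** When all horizontal inputs are 0, a vertical bit 1 can only run straight down. *)
Lemma sum_column_wt_false v us (F : seq bool -> R) :
  \sum_(g <- bits (size us)) column_wt v us true true (nseq (size us) false) g * F g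
    = (\prod_(u <- us) b u v) * F (nseq (size us) false).
Proof.
elim: us F => [|u us IH] F /=; first by rewrite big_bits0 big_nil.
rewrite big_bitsS /= big_cons addrC big1 ?add0r => [|g _]; last first.
  by rewrite !mul0r addr0 mul0r.
rewrite -mulrA -(IH (fun g => F (false :: g))) mulr_sumr.
by apply: eq_bigr => g _; rewrite mul0r add0r mulrA.
Qed.

(** A vertical 1 entering a vertex whose right output is 1 forces all four bits to be 1. *)
Lemma column_wt_true v us h : size h = size us ->
  column_wt v us true true h (nseq (size us) true)
    = (\prod_(u <- us) a1 u v) * (h == nseq (size us) true)%:R.
Proof.
elim: us h => [|u us IH] [|x h] //=; first by rewrite big_nil mul1r.
case=> szh; rewrite IH // big_cons eqseq_cons.
by case: x; rewrite /= ?mul0r ?add0r ?mulr0 ?mulrA.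
Qed.

(* If [a0 u v = 0] the corner carries the 1 of its row and of its column, which
   freezes both lines. *)
Lemma Zdw_left_corner u us v vs : a0 u v = 0 ->
  Zdw (u :: us) (v :: vs)
    = (\prod_(w <- vs) b u w) * (\prod_(t <- us) b t v) * Zdw us vs.
Proof.
by move=> a00; rewrite /Zdw [nseq _ _]/= Zstate_cons_false a00 mul0r add0r
  sum_column_wt_false mulrA.
Qed.

Lemma size_bits n g : g \in bits n -> size g = n.
Proof. by rewrite mem_words => /andP[/eqP]. Qed.

(** Mirror image of [Zdw_left_corner]: since [b] vanishes at the top right corner, that corner
    cannot hold a 0. It holds the 1 of the top row, with weights [a0] to its left and [a1] below.
    The bits [h] are general for the induction on columns. *)
Lemma Zstate_right_corner u us v vs h : b u v = 0 -> size h = size us ->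
  Zstate (u :: us) (rcons vs v) (false :: h)
    = (\prod_(w <- vs) a0 u w) * (\prod_(t <- us) a1 t v) * Zstate us vs h.
Proof.
move=> b0; elim: vs h => [|w vs IH] h szh.
  rewrite [rcons _ _]/= Zstate_cons_false !big_nil !mul1r big1 ?mulr0 ?add0r.
    rewrite -column_wt_true //= (bigD1_seq (nseq (size us) true)) /=; first last.
    - exact: uniq_words.
    - by rewrite mem_words size_nseq eqxx all_nseq orbT.
    rewrite eqxx mulr1 big1 ?addr0 // => g /negPf->.
    by rewrite mulr0.
  by move=> g _; rewrite mulr0.
rewrite rcons_cons Zstate_cons_false !big_cons big_rcons b0 /=.
rewrite !mulr0 mul0r addr0 -!mulrA; congr (_ * _).
rewrite !mulr_sumr !big_seq; apply: eq_bigr => g /size_bits szg.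
by rewrite IH //; ring.
Qed.

End Transfer.

Lemma rmorph_Zstate (R S : comNzRingType) (U V U' V' : Type) (f : {rmorphism R -> S})
    (fu : U -> U') (fv : V -> V') (a0 a1 b d : U -> V -> R)
    (a0' a1' b' d' : U' -> V' -> S) :
    (forall u v, f (a0 u v) = a0' (fu u) (fv v)) ->
    (forall u v, f (a1 u v) = a1' (fu u) (fv v)) ->
    (forall u v, f (b u v) = b' (fu u) (fv v)) ->
    (forall u v, f (d u v) = d' (fu u) (fv v)) ->
  forall us vs h,
    f (Zstate a0 a1 b d us vs h) = Zstate a0' a1' b' d' (map fu us) (map fv vs) h.
Proof.
move=> fa0 fa1 fb fd us vs.
have fvtx u v k h k' h' : f (vertex_wt a0 a1 b d u v k h k' h')
    = vertex_wt a0' a1' b' d' (fu u) (fv v) k h k' h'.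
  by case: k h k' h' => [] [] [] [] /=; rewrite ?rmorph0 ?rmorph1.
have fcol v k k' h h' : f (column_wt a0 a1 b d v us k k' h h')
    = column_wt a0' a1' b' d' (fv v) (map fu us) k k' h h'.
  elim: us k h h' => [|u us IH] k [|x h] [|x' h'] /=; rewrite ?rmorph0 //.
    by rewrite rmorph_nat.
  by rewrite rmorphD !rmorphM /= !fvtx !IH.
elim: vs => [|v vs IH] h /=; first by rewrite rmorph_nat size_map.
rewrite rmorph_sum size_map; apply: eq_bigr => g _.
by rewrite rmorphM /= fcol IH.
Qed.

(** * Commuting columns *)

Section SixVertex.
Variables (R : comNzRingType) (l l' : R).
Let p := l * l'.

(* The usual trigonometric weights have [l = l'].  The ratio [l / l'] is a gauge
   freedom, harmless for domain walls, used below to make [a1] and [b] both 1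
   at the homogeneous point, so that only [a0] records nu. *)
Definition wa0 (u v : R) := l * (u - v).
Definition wa1 (u v : R) := l' * (u - v).
Definition wb (u v : R) := p * u - v.
Definition wd (u v : R) := (p - 1) ^+ 2 * u * v.

Local Notation vertex_wt := (vertex_wt wa0 wa1 wb wd).
Local Notation column_wt := (column_wt wa0 wa1 wb wd).

Definition Z6v := Zdw wa0 wa1 wb wd.

(** The trigonometric R-matrix that exchanges two columns. On the states 00 and 11, the ones met by
    domain walls, it acts as the scalar [wb w v]. *)
Definition Rmx (v w : R) (s t : bool * bool) : R :=
  match s, t with
  | (false, false), (false, false) | (true, true), (true, true) => wb w v
  | (false, true), (false, true) => (p - 1) * v
  | (true, false), (true, false) => (p - 1) * w
  | (false, true), (true, false) => wa1 w v
  | (true, false), (false, true) => wa0 w v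
  | _, _ => 0
  end.

Definition vertex2 u v w (s t : bool * bool) (h h' : bool) : R :=
  \sum_(g : bool) vertex_wt u v s.1 h t.1 g * vertex_wt u w s.2 g t.2 h'.

Definition column2 us v w (s t : bool * bool) (h h' : seq bool) : R :=
  \sum_(g <- bits (size us)) column_wt v us s.1 t.1 h g * column_wt w us s.2 t.2 g h'.

Lemma big_bool2 (F : bool * bool -> R) :
  \sum_t F t = F (true, true) + F (true, false)
               + (F (false, true) + F (false, false)).
Proof.
have -> : \sum_t F t = \sum_(i : bool) \sum_(j : bool) F (i, j).
  by rewrite pair_bigA; apply: eq_bigr => -[].
by rewrite !big_bool.
Qed.

(** The Yang-Baxter equation for one row: each of the 64 boundary conditions is a polynomial
    identity. *)
Lemma yang_baxter u v w s m h h' :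
  \sum_t Rmx v w s t * vertex2 u v w t m h h'
    = \sum_t vertex2 u w v s t h h' * Rmx v w t m.
Proof.
case: s m h h' => [[] []] [[] []] [] []; rewrite !big_bool2 /vertex2 !big_bool /=;
  rewrite /wa0 /wa1 /wb /wd /p; ring.
Qed.

Lemma column2_cons u us v w s t x h x' h' :
  column2 (u :: us) v w s t (x :: h) (x' :: h')
    = \sum_m vertex2 u v w s m x x' * column2 us v w m t h h'.
Proof.
rewrite /column2 [size _]/= big_bitsS /= big_bool2 !mulr_sumr -!big_split /=.
by apply: eq_bigr => g _; rewrite /vertex2 !big_bool /=; ring.
Qed.

(** The R-matrix is pushed down the two columns, one row at a time, by [yang_baxter]. *)
Lemma RTT us v w s m h h' :
  \sum_t Rmx v w s t * column2 us v w t m h h'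
    = \sum_t column2 us w v s t h h' * Rmx v w t m.
Proof.
elim: us s h h' => [|u us IH] s [|x h] [|x' h'].
- rewrite !big_bool2 /column2 !big_bits0 /=.
  by case: s m => [[] []] [[] []] /=; ring.
- by rewrite !big1 // => t _; rewrite /column2 big_bits0 /= ?mulr0 ?mul0r.
- by rewrite !big1 // => t _; rewrite /column2 big_bits0 /= mul0r ?mulr0 ?mul0r.
- by rewrite !big1 // => t _; rewrite /column2 big_bits0 /= mul0r ?mulr0 ?mul0r.
- by rewrite !big1 // => t _; rewrite /column2 big1 ?mulr0 ?mul0r // => -[|? ?] _;
    rewrite mul0r.
- by rewrite !big1 // => t _; rewrite /column2 big1 ?mulr0 ?mul0r // => -[|? ?] _;
    rewrite mul0r.
- by rewrite !big1 // => t _; rewrite /column2 big1 ?mulr0 ?mul0r // => -[|? ?] _;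
    rewrite mulr0.
under eq_bigr => t _ do rewrite column2_cons mulr_sumr.
under [RHS]eq_bigr => t _ do rewrite column2_cons mulr_suml.
rewrite exchange_big [RHS]exchange_big /=.
transitivity (\sum_i (\sum_t vertex2 u w v s t x x' * Rmx v w t i)
                * column2 us v w i m h h').
  apply: eq_bigr => i _; rewrite -(yang_baxter u v w s i x x') mulr_suml.
  by apply: eq_bigr => t _; rewrite mulrA.
under [LHS]eq_bigr => i _ do rewrite mulr_suml.
rewrite exchange_big /=; apply: eq_bigr => t _.
under [LHS]eq_bigr => i _ do rewrite -mulrA.
rewrite -mulr_sumr IH mulr_sumr; apply: eq_bigr => i _.
by rewrite mulrA.
Qed.

(** Domain walls select the entry of [RTT] from 00 to 11, where the R-matrix is scalar. The scalar
    stays because it may vanish. *)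
Lemma column_wt_comm us v w h h' :
  wb w v * (\sum_(g <- bits (size us))
              column_wt v us false true h g * column_wt w us false true g h')
  = wb w v * (\sum_(g <- bits (size us))
                column_wt w us false true h g * column_wt v us false true g h').
Proof.
have := RTT us v w (false, false) (true, true) h h'.
by rewrite !big_bool2 /= !mul0r !mulr0 !addr0 !add0r mulrC => ->; rewrite mulrC.
Qed.

End SixVertex.

(** * The Izergin-Korepin determinant *)

Definition del (T : Type) (j : nat) (s : seq T) := take j s ++ drop j.+1 s.

Lemma nth_del (T : Type) (x : T) j s k :
  (j <= size s)%N -> nth x (del j s) k = nth x s (bump j k).
Proof.
move=> js; rewrite nth_cat size_takel // /bump; case: ltnP => [kj|jk].
  by rewrite nth_take.
by rewrite nth_drop addSn subnKC.
Qed.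

Lemma del_split (T : Type) (x : T) j s :
  (j < size s)%N -> s = take j s ++ nth x s j :: drop j.+1 s.
Proof. by move=> js; rewrite -drop_nth // cat_take_drop. Qed.

Lemma size_del (T : Type) j (s : seq T) n :
  size s = n.+1 -> (j < n.+1)%N -> size (del j s) = n.
Proof.
move=> sn js; rewrite size_cat size_drop size_takel sn; last exact: ltnW.
by rewrite subSS subnKC.
Qed.

Lemma perm_del (T : eqType) (x : T) j s :
  (j < size s)%N -> perm_eq s (nth x s j :: del j s).
Proof.
by move=> js; rewrite {1}(del_split x js) perm_catC /= perm_cons perm_catC.
Qed.

Section IzerginKorepin.
Variables (K : fieldType) (l l' : K).
Let p := l * l'.

Local Notation wB := (wb l l').
Local Notation column_wt := (column_wt (wa0 l) (wa1 l') wB (wd l l')).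
Local Notation Zstate := (Zstate (wa0 l) (wa1 l') wB (wd l l')).
Local Notation Z := (Z6v l l').

Lemma Zstate_front us pre v post h : {in pre, forall w, wB v w != 0} ->
  Zstate us (pre ++ v :: post) h = Zstate us (v :: pre ++ post) h.
Proof.
elim: pre h => [//|w pre IH] h vw.
have vpre : {in pre, forall t, wB v t != 0}.
  by move=> t tpre; apply: vw; rewrite inE tpre orbT.
have {}vw : wB v w != 0 by apply: vw; rewrite mem_head.
rewrite cat_cons [LHS]/=; under eq_bigr => g _ do rewrite IH //.
rewrite cat_cons /=.
under eq_bigr => g _ do rewrite mulr_sumr.
under [RHS]eq_bigr => g _ do rewrite mulr_sumr.
rewrite exchange_big [RHS]exchange_big /=; apply: eq_bigr => g _.
under eq_bigr => i _ do rewrite mulrA.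
under [RHS]eq_bigr => i _ do rewrite mulrA.
rewrite -!mulr_suml; congr (_ * _); apply: (mulfI vw).
exact: column_wt_comm.
Qed.

(* [Zstate] as a polynomial in the parameter of an additional top row. *)
Fixpoint zpoly (us vs : seq K) (h : seq bool) : {poly K} :=
  if vs is v :: vs then
    l *: ('X - v%:P)
      * (\sum_(g <- bits (size us)) column_wt v us false true h g *: zpoly us vs g)
    + (\prod_(w <- vs) (p *: 'X - w%:P))
      * (\sum_(g <- bits (size us)) column_wt v us true true h g * Zstate us vs g)%:P
  else 0.

Lemma horner_zpoly us vs h t : (zpoly us vs h).[t] = Zstate (t :: us) vs (false :: h).
Proof.
elim: vs h => [|v vs IH] h; first by rewrite horner0.
rewrite Zstate_cons_false /= !hornerE horner_sum horner_prod.
congr (_ * _ + _ * _).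
  by apply: eq_bigr => g _; rewrite hornerZ IH.
by apply: eq_bigr => w _; rewrite !hornerE.
Qed.

Lemma size_lin (a c : K) : (size (a *: 'X - c%:P)%R <= 2)%N.
Proof.
rewrite (leq_trans (size_polyD _ _)) // geq_max size_polyN.
rewrite (leq_trans (size_scale_leq _ _)) ?size_polyX //=.
by rewrite (leq_trans (size_polyC_leq1 _)).
Qed.

Lemma size_prod_le (I : Type) (s : seq I) (F : I -> {poly K}) m :
  (forall i, size (F i) <= m.+1)%N ->
  (size (\prod_(i <- s) F i)%R <= (m * size s).+1)%N.
Proof.
move=> szF; elim: s => [|i s IH]; first by rewrite big_nil size_poly1.
rewrite big_cons (leq_trans (size_polyMleq _ _)) //=.
by rewrite -subn1 leq_subLR add1n mulnS -addnS -addSn leq_add.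
Qed.

(** The 1 of the top row has constant weight, and every other vertex of that row has a weight of
    degree at most 1. *)
Lemma size_zpoly us vs h : (size (zpoly us vs h) <= size vs)%N.
Proof.
elim: vs h => [|v vs IH] h; first by rewrite size_poly0.
rewrite (leq_trans (size_polyD _ _)) // geq_max; apply/andP; split.
  rewrite (leq_trans (size_polyMleq _ _)) //.
  have szX : (size (l *: ('X - v%:P))%R <= 2)%N.
    by rewrite (leq_trans (size_scale_leq _ _)) // size_XsubC.
  have szS : (size (\sum_(g <- bits (size us)) column_wt v us false true h g
       *: zpoly us vs g)%R <= size vs)%N.
    rewrite (leq_trans (size_sum _ _ _)) //; apply/bigmax_leqP_seq => g _ _.
    by rewrite (leq_trans (size_scale_leq _ _)).
  by have := leq_add szX szS; rewrite add2n -subn1 leq_subLR add1n.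
rewrite mulrC mul_polyC (leq_trans (size_scale_leq _ _)) //.
rewrite -[size (v :: vs)]/(size vs).+1 -[size vs]mul1n.
by apply: size_prod_le => w; apply: size_lin.
Qed.

Definition gw (u v : K) := (u - v) * wB u v.
Definition gpoly (v : K) : {poly K} := ('X - v%:P) * (p *: 'X - v%:P).
Definition gprod (us vs : seq K) := \prod_(u <- us) \prod_(v <- vs) gw u v.

Definition IKmx n (us vs : seq K) : 'M[K]_n :=
  \matrix_(i, j) (gw us`_i vs`_j)^-1.

(** Vandermonde products. Differences are later minus earlier for the rows, and earlier minus later
    ([vdmr]) for the columns. *)
Fixpoint vdm (us : seq K) : K :=
  if us is u :: us then (\prod_(t <- us) (t - u)) * vdm us else 1.

Fixpoint vdmr (vs : seq K) : K :=
  if vs is v :: vs then (\prod_(w <- vs) (v - w)) * vdmr vs else 1.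

(** Required of the joint list of row and column parameters, this makes every [gw] invertible and
    lets columns commute by cancellation. *)
Definition generic (s : seq K) :=
  uniq s /\ {in s &, forall a b, a != b -> wB a b != 0}.

Lemma generic_sub s t : uniq s -> {subset s <= t} -> generic t -> generic s.
Proof.
by move=> us st [_ gt]; split=> // a b /st ta /st tb; apply: gt.
Qed.

Lemma generic_perm s t : perm_eq s t -> generic t -> generic s.
Proof.
move=> st gt; apply: generic_sub (gt) => [|a]; last by rewrite (perm_mem st).
by rewrite (perm_uniq st) gt.1.
Qed.

Lemma generic_cons a s : generic (a :: s) -> generic s.
Proof.
move=> gs; apply: generic_sub (gs) => [|b bs]; last by rewrite inE bs orbT.
by case: gs => /andP[].
Qed.

Lemma horner_gpoly v t : (gpoly v).[t] = gw t v.
Proof. by rewrite !hornerE. Qed.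

Lemma size_gpoly v : (size (gpoly v) <= 3)%N.
Proof.
rewrite (leq_trans (size_polyMleq _ _)) // size_XsubC.
by rewrite add2n; apply: size_lin.
Qed.

(** The sign produced by moving [v] to the front matches the cofactor sign in [det_IKmx]. *)
Lemma vdmr_front pre v post :
  vdmr (pre ++ v :: post)
    = (-1) ^+ size pre * (\prod_(w <- pre ++ post) (v - w)) * vdmr (pre ++ post).
Proof.
elim: pre => [|a pre IH] /=; first by rewrite mul1r.
rewrite IH !big_cat !big_cons /= exprS big_cat /=; ring.
Qed.

Lemma det_IKmx n u us vs : size vs = n.+1 ->
  \det (IKmx n.+1 (u :: us) vs)
    = \sum_(j < n.+1) (gw u vs`_j)^-1 * ((-1) ^+ j * \det (IKmx n us (del j vs))).
Proof.
move=> szvs; rewrite (expand_det_row _ 0); apply: eq_bigr => j _.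
rewrite mxE /cofactor add0n; congr (_ * (_ * \det _)).
by apply/matrixP => i k; rewrite !mxE /= nth_del // szvs ltnW.
Qed.

Lemma gw_neq0 u us v vs :
  generic (us ++ vs) -> u \in us -> v \in vs -> gw u v != 0.
Proof.
move=> [uv gen] uus vvs.
have nuv : u != v.
  move: uv; rewrite cat_uniq => /and3P[_ /hasPn/(_ _ vvs) vus _].
  by apply: contraNneq vus => <-.
apply: mulf_neq0; first by rewrite subr_eq0.
by apply: gen => //; rewrite mem_cat ?uus ?vvs ?orbT.
Qed.

(* As polynomials in the parameter of the first row, both sides have degree at
   most [2 * (n - 1)] and agree at [2 * n - 1] points: at the column parameters
   the corner freezes and the induction hypothesis applies, and at the other row
   parameters both sides vanish. *)
Lemma izergin_korepin n us vs : size us = n -> size vs = n ->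
  generic (us ++ vs) ->
  gprod us vs * \det (IKmx n us vs) = vdm us * vdmr vs * Z us vs.
Proof.
elim: n us vs => [|n IH] us vs.
  move=> /size0nil-> /size0nil-> _.
  by rewrite det_mx00 /gprod big_nil /Z6v /Zdw /= !mulr1.
case: us => [//|u0 us] [szus] szvs gen0.
have gen := generic_cons gen0.
(* [Q] is the expansion of the determinant along its first row with denominators cleared: a
   polynomial in the first row parameter, defined also where some [gw] vanishes. *)
pose c j := (-1) ^+ j * gprod us vs * \det (IKmx n us (del j vs)).
pose Q := \sum_(j < n.+1) c j *: \prod_(w <- del j vs) gpoly w.
have QE t : {in vs, forall v, gw t v != 0} ->
    Q.[t] = gprod (t :: us) vs * \det (IKmx n.+1 (t :: us) vs).
  move=> tv; rewrite det_IKmx // /gprod big_cons mulr_sumr horner_sum.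
  apply: eq_bigr => j _; rewrite hornerZ horner_prod.
  have jvs : (j < size vs)%N by rewrite szvs.
  rewrite (perm_big _ (perm_del 0 jvs)) big_cons /=.
  under eq_bigr => w _ do rewrite horner_gpoly.
  have := tv _ (mem_nth 0 jvs); rewrite /c /gprod => gn0.
  by field.
pose P := (vdm us * vdmr vs) *: ((\prod_(t <- us) (t%:P - 'X))
            * zpoly us vs (nseq n false)).
have PE t : P.[t] = vdm us * vdmr vs * (\prod_(w <- us) (w - t)) * Z (t :: us) vs.
  rewrite hornerZ hornerM horner_zpoly -mulrA horner_prod /Z6v /Zdw /= szus.
  congr (_ * (_ * _)); apply: eq_bigr => w _.
  by rewrite !hornerE.
suff PQ : P = Q.
  rewrite -QE => [|v vvs]; last by apply: gw_neq0 gen0 _ vvs; rewrite mem_head.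
  by rewrite -PQ PE /=; ring.
apply/eqP; rewrite -subr_eq0; apply/eqP.
apply: (@roots_geq_poly_eq0 _ _ (us ++ vs)).
- apply/allP => t; rewrite mem_cat => /orP[tus|tvs].
    rewrite rootE hornerD hornerN PE QE; last first.
      by move=> v vvs; apply: gw_neq0 gen tus vvs.
    (* At another row parameter a Vandermonde factor kills [P], and two equal rows kill the
       determinant in [Q]. *)
    rewrite (perm_big _ (perm_to_rem tus)) big_cons /= subrr mul0r mulr0 mul0r.
    rewrite sub0r oppr_eq0 mulf_eq0; apply/orP; right; apply/eqP.
    have tn : (index t us < n)%N by rewrite -szus index_mem.
    apply: (@determinant_alternate _ _ _ 0 (lift 0 (Ordinal tn))) => // j.
    by rewrite !mxE /= nth_index.
  rewrite rootE hornerD hornerN PE subr_eq0; apply/eqP.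
  have jvs : (index t vs < size vs)%N by rewrite index_mem.
  have jn : (index t vs < n.+1)%N by rewrite -szvs.
  (* At a column parameter [t], every summand of [Q] except the one deleting [t] contains the factor
     [gpoly t], which vanishes there. *)
  rewrite horner_sum (bigD1 (Ordinal jn)) //= [X in _ + X]big1 ?addr0.
    set j := index t vs in jvs jn *.
    have tj : nth 0 vs j = t by rewrite nth_index.
    have pd := perm_del 0 jvs; rewrite tj in pd.
    have gd : generic (us ++ del j vs).
      apply: (@generic_cons t); apply: generic_perm gen.
      rewrite perm_sym (perm_trans (perm_cat (perm_refl us) pd)) //.
      by rewrite perm_catC /= perm_cons perm_catC.
    have td : {in del j vs, forall w, wB t w != 0}.
      move=> w wd; apply: gen.2.
      - by rewrite mem_cat tvs orbT.
      - by rewrite mem_cat (perm_mem pd) inE wd !orbT.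
      - have := gen.1; rewrite cat_uniq (perm_uniq pd) => /and3P[_ _] /=.
        by case/andP=> tnd _; apply: contraNneq tnd => ->.
    (* The column of parameter [t] is moved to the front; its corner weight [a0] is then 0. *)
    have Zt : Z (t :: us) vs = (\prod_(w <- del j vs) wB t w)
         * (\prod_(w <- us) wB w t) * Z us (del j vs).
      rewrite -Zdw_left_corner; last by rewrite /wa0 subrr mulr0.
      rewrite /Z6v /Zdw {1}(del_split 0 jvs) Zstate_front ?tj // => w wt.
      by apply: td; rewrite mem_cat wt.
    rewrite Zt {1}(del_split 0 jvs) tj vdmr_front size_takel ?(ltnW jvs) //.
    have -> : (c j *: \prod_(w <- del j vs) gpoly w).[t]
        = c j * \prod_(w <- del j vs) gw t w.
      rewrite hornerZ horner_prod; congr (_ * _).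
      by apply: eq_bigr => w _; rewrite horner_gpoly.
    rewrite /c.
    have -> : gprod us vs = (\prod_(u <- us) gw u t) * gprod us (del j vs).
      rewrite /gprod -big_split /=; apply: eq_bigr => u _.
      by rewrite (perm_big _ pd) big_cons.
    transitivity ((-1) ^+ j * (\prod_(u <- us) gw u t)
        * (gprod us (del j vs) * \det (IKmx n us (del j vs)))
        * \prod_(w <- del j vs) gw t w); last by ring.
    rewrite (IH us) ?(size_del szvs) //.
    by rewrite /gw !big_split /= -/(del j vs); ring.
  move=> i ij.
  have tdel : t \in del i vs.
    have := tvs; rewrite (perm_mem (@perm_del _ 0 i vs _)) ?szvs // inE.
    case/orP=> // /eqP ti; case/negP: ij; apply/eqP/val_inj => /=.
    rewrite ti index_uniq ?szvs //.
    by have := gen.1; rewrite cat_uniq => /and3P[].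
  rewrite hornerZ horner_prod (perm_big _ (perm_to_rem tdel)) big_cons.
  by rewrite horner_gpoly /gw subrr mul0r /= mul0r mulr0.
- by case: gen.
(* The matrix has size n + 1 here: both polynomials have degree at most 2n, and there are 2n + 1
   points. *)
rewrite size_cat szus szvs (leq_trans (size_polyD _ _)) // geq_max size_polyN.
apply/andP; split.
  rewrite (leq_trans (size_scale_leq _ _)) //.
  rewrite (leq_trans (size_polyMleq _ _)) //.
  have sz1 : (size (\prod_(t <- us) (t%:P - 'X) : {poly K})%R <= n.+1)%N.
    rewrite -[n]mul1n -szus; apply: size_prod_le => t.
    by rewrite -opprB size_polyN size_XsubC.
  have := leq_add sz1 (size_zpoly us vs (nseq n false)).
  by rewrite szvs addSn -subn1 leq_subLR add1n.
rewrite (leq_trans (size_sum _ _ _)) //; apply/bigmax_leqP => j _.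
rewrite (leq_trans (size_scale_leq _ _)) //.
have /= szg := size_prod_le (del j vs) size_gpoly.
by rewrite addnS addnn -mul2n (leq_trans szg) // (size_del szvs).
Qed.

End IzerginKorepin.

(** * A bilinear identity from Desnanot-Jacobi *)

Lemma det_mx2 (R : comNzRingType) (A : 'M[R]_2) :
  \det A = A 0 0 * A 1 1 - A 0 1 * A 1 0.
Proof.
rewrite (expand_det_row _ 0) !big_ord_recl big_ord0 addr0 /cofactor !det_mx11.
rewrite !mxE /= expr0 expr1 mul1r mulN1r mulrN.
by congr (A _ _ * A _ _ - A _ _ * A _ _); apply/val_inj.
Qed.

Lemma desnanot_jacobi_unit (R : idomainType) m (M : 'M[R]_(2 + m)) :
  \det M != 0 ->
  \det M * \det (drsubmx M)
    = \det (row' 0 (col' 0 M)) * \det (row' 1 (col' 1 M))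
      - \det (row' 0 (col' 1 M)) * \det (row' 1 (col' 0 M)).
Proof.
move=> M0.
(* The identity matrix with its first two columns taken from the adjugate. *)
pose X := block_mx (ulsubmx (\adj M)) 0 (dlsubmx (\adj M)) 1%:M : 'M_(2 + m).
have MX : M *m X = block_mx (\det M)%:M (ursubmx M) 0 (drsubmx M).
  have := mul_mx_adj M.
  rewrite -{1}[M]submxK -{1}[\adj M]submxK mulmx_block scalar_mx_block.
  case/eq_block_mx => eul _ edl _.
  by rewrite /X -{1}[M]submxK mulmx_block eul edl !mulmx0 !mulmx1 !add0r.
have := congr1 determinant MX.
(* By [MX], det M times a 2 by 2 minor of the adjugate equals (det M)^2 times the complementary
   minor of M; one det M cancels. *)
rewrite det_mulmx det_lblock det_ublock det1 mulr1 det_scalar expr2 -mulrA.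
move/(mulfI M0) => <-; rewrite det_mx2 !mxE.
rewrite (_ : lshift m 0 = 0); last by apply/val_inj.
rewrite (_ : lshift m 1 = 1); last by apply/val_inj.
rewrite /cofactor /= expr0 expr1 expr2; ring.
Qed.

Lemma desnanot_jacobi (R : idomainType) m (M : 'M[R]_(2 + m)) :
  \det M * \det (drsubmx M)
    = \det (row' 0 (col' 0 M)) * \det (row' 1 (col' 1 M))
      - \det (row' 0 (col' 1 M)) * \det (row' 1 (col' 0 M)).
Proof.
(* Perturbing [M] by ['X] makes its determinant monic, hence nonzero. *)
pose N : 'M[{poly R}]_(2 + m) := char_poly_mx (- M).
have N0 : map_mx (horner_eval 0) N = M.
  apply/matrixP => i j; rewrite !mxE /horner_eval hornerD hornerN hornerMn.
  by rewrite hornerX hornerC mul0rn sub0r opprK.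
have := congr1 (horner_eval 0)
  (desnanot_jacobi_unit (monic_neq0 (char_poly_monic (- M)))).
rewrite rmorphB !rmorphM /= -!det_map_mx map_drsubmx.
have minorE i j : map_mx (horner_eval 0) (row' i (col' j N)) = row' i (col' j M).
  by rewrite -N0; apply/matrixP => a b; rewrite !mxE.
by rewrite -/N (minorE 0 0) (minorE 1 1) (minorE 0 1) (minorE 1 0) N0.
Qed.

Section Bilinear.
Variables (K : fieldType) (l l' : K).
Local Notation Z := (Z6v l l').
Local Notation gw := (gw l l').
Local Notation IKmx := (IKmx l l').
Local Notation gprod := (gprod l l').

Lemma vdm_neq0 (s : seq K) : uniq s -> vdm s != 0.
Proof.
elim: s => [|a s IH] /=; first by rewrite oner_neq0.
case/andP=> as_ /IH s0; rewrite mulf_neq0 // prodf_seq_neq0.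
apply/allP => t ts /=; rewrite subr_eq0.
by apply: contraNneq as_ => <-.
Qed.

Lemma vdmr_neq0 (s : seq K) : uniq s -> vdmr s != 0.
Proof.
elim: s => [|a s IH] /=; first by rewrite oner_neq0.
case/andP=> as_ /IH s0; rewrite mulf_neq0 // prodf_seq_neq0.
apply/allP => t ts /=; rewrite subr_eq0.
by apply: contraNneq as_ => ->.
Qed.

(** Deleting a row or column of an Izergin-Korepin matrix deletes its parameter, so all the minors
    are again of this kind. *)
Lemma desnanot_jacobi_IKmx n u1 u2 us v1 v2 vs :
  \det (IKmx n.+2 [:: u1, u2 & us] [:: v1, v2 & vs]) * \det (IKmx n us vs)
  = \det (IKmx n.+1 (u2 :: us) (v2 :: vs)) * \det (IKmx n.+1 (u1 :: us) (v1 :: vs))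
    - \det (IKmx n.+1 (u2 :: us) (v1 :: vs))
      * \det (IKmx n.+1 (u1 :: us) (v2 :: vs)).
Proof.
set M := IKmx _ _ _.
have := desnanot_jacobi (M : 'M_(2 + n)).
have lift1 (w1 w2 : K) ws (i : 'I_n.+1) :
    [:: w1, w2 & ws]`_(lift (1 : 'I_n.+2) i) = (w1 :: ws)`_i.
  by case: i => -[|i] ?.
have -> : drsubmx (M : 'M_(2 + n)) = IKmx n us vs.
  by apply/matrixP => i j; rewrite !mxE.
have -> : row' 0 (col' 0 M) = IKmx n.+1 (u2 :: us) (v2 :: vs).
  by apply/matrixP => i j; rewrite !mxE.
have -> : row' 1 (col' 1 M) = IKmx n.+1 (u1 :: us) (v1 :: vs).
  by apply/matrixP => i j; rewrite !mxE !lift1.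
have -> : row' 0 (col' 1 M) = IKmx n.+1 (u2 :: us) (v1 :: vs).
  by apply/matrixP => i j; rewrite !mxE !lift1.
have -> : row' 1 (col' 0 M) = IKmx n.+1 (u1 :: us) (v2 :: vs).
  by apply/matrixP => i j; rewrite !mxE !lift1.
by [].
Qed.

Lemma Z6v_bilinear_generic u1 u2 us v1 v2 vs : size us = size vs ->
  generic l l' ([:: u1, u2 & us] ++ [:: v1, v2 & vs]) ->
  (u2 - u1) * (v1 - v2) * Z [:: u1, u2 & us] [:: v1, v2 & vs] * Z us vs
  = gw u1 v2 * gw u2 v1 * Z (u2 :: us) (v2 :: vs) * Z (u1 :: us) (v1 :: vs)
    - gw u1 v1 * gw u2 v2 * Z (u2 :: us) (v1 :: vs) * Z (u1 :: us) (v2 :: vs).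
Proof.
move=> szuv gen.
have [uniq_all _] := gen.
have sub s t : subseq s [:: u1, u2 & us] -> subseq t [:: v1, v2 & vs] ->
    generic l l' (s ++ t).
  move=> ss st; apply: generic_sub (gen).
    exact: subseq_uniq (cat_subseq ss st) uniq_all.
  exact: mem_subseq (cat_subseq ss st).
have sub1 (a b : K) s : subseq (b :: s) [:: a, b & s].
  by apply: subseq_cons.
have sub2 (a b : K) s : subseq (a :: s) [:: a, b & s].
  exact: (cat_subseq (subseq_refl [:: a]) (subseq_cons s b)).
have sub3 (a b : K) s : subseq s [:: a, b & s].
  by apply: subseq_trans (subseq_cons _ b) (subseq_cons _ a).
pose n := size us.
have ik := @izergin_korepin K l l'.
have e0 := ik n.+2 [:: u1, u2 & us] [:: v1, v2 & vs] erefl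
  (congr1 (fun k => k.+2) (esym szuv)) gen.
have e3 := ik n us vs erefl (esym szuv) (sub _ _ (sub3 _ _ _) (sub3 _ _ _)).
have e22 := ik n.+1 (u2 :: us) (v2 :: vs) erefl (congr1 succn (esym szuv))
  (sub _ _ (sub1 _ _ _) (sub1 _ _ _)).
have e11 := ik n.+1 (u1 :: us) (v1 :: vs) erefl (congr1 succn (esym szuv))
  (sub _ _ (sub2 _ _ _) (sub2 _ _ _)).
have e21 := ik n.+1 (u2 :: us) (v1 :: vs) erefl (congr1 succn (esym szuv))
  (sub _ _ (sub1 _ _ _) (sub2 _ _ _)).
have e12 := ik n.+1 (u1 :: us) (v2 :: vs) erefl (congr1 succn (esym szuv))
  (sub _ _ (sub2 _ _ _) (sub1 _ _ _)).
have uu : uniq [:: u1, u2 & us].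
  by move: uniq_all; rewrite cat_uniq => /and3P[].
have uv : uniq [:: v1, v2 & vs].
  by move: uniq_all; rewrite cat_uniq => /and3P[].
have A1 := vdm_neq0 (subseq_uniq (sub1 _ _ _) uu).
have A2 := vdm_neq0 (subseq_uniq (sub2 _ _ _) uu).
have B1 := vdmr_neq0 (subseq_uniq (sub1 _ _ _) uv).
have B2 := vdmr_neq0 (subseq_uniq (sub2 _ _ _) uv).
(* The Vandermonde products of the full and the doubly shortened lists multiply to those of the two
   singly shortened lists times u2 - u1, respectively v1 - v2; hence these factors on the left. *)
apply: (mulfI (mulf_neq0 (mulf_neq0 A1 A2) (mulf_neq0 B1 B2))).
have dj := desnanot_jacobi_IKmx n u1 u2 us v1 v2 vs.
transitivity (gprod [:: u1, u2 & us] [:: v1, v2 & vs] * gprod us vs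
   * (\det (IKmx n.+2 [:: u1, u2 & us] [:: v1, v2 & vs]) * \det (IKmx n us vs))).
  rewrite [RHS]mulrACA e0 e3 /= !big_cons; ring.
have gE u s v t : gprod (u :: s) (v :: t)
    = gw u v * \prod_(w <- t) gw u w * (\prod_(w <- s) gw w v * gprod s t).
  rewrite /gprod !big_cons; congr (_ * _).
  by rewrite -big_split; apply: eq_bigr => w _; rewrite big_cons.
(* Each pair of [gprod] on the right misses two of the four factors [gw] between u1, u2 and v1, v2;
   they appear in front. *)
transitivity (gw u1 v2 * gw u2 v1
     * (gprod (u2 :: us) (v2 :: vs) * \det (IKmx n.+1 (u2 :: us) (v2 :: vs)))
     * (gprod (u1 :: us) (v1 :: vs) * \det (IKmx n.+1 (u1 :: us) (v1 :: vs)))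
   - gw u1 v1 * gw u2 v2
     * (gprod (u2 :: us) (v1 :: vs) * \det (IKmx n.+1 (u2 :: us) (v1 :: vs)))
     * (gprod (u1 :: us) (v2 :: vs) * \det (IKmx n.+1 (u1 :: us) (v2 :: vs)))).
  by rewrite dj !gE !big_cons; ring.
rewrite e22 e11 e21 e12 /=; ring.
Qed.

End Bilinear.

Lemma rmorph_Z6v (R S : comNzRingType) (f : {rmorphism R -> S}) (l l' : R) us vs :
  f (Z6v l l' us vs) = Z6v (f l) (f l') (map f us) (map f vs).
Proof.
rewrite /Z6v /Zdw size_map; apply: rmorph_Zstate => u v;
  by rewrite /wa0 /wa1 /wb /wd !(rmorphM, rmorphB, rmorphXn, rmorph1).
Qed.

(* Distinct powers of ['X] make any list of parameters generic; setting ['X] to 0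
   removes the genericity assumption from polynomial identities. *)
Section Perturbation.
Variable F : fieldType.

Fixpoint perturb (k : nat) (s : seq F) : seq {poly F} :=
  if s is x :: s then x%:P + 'X^(k.+1) :: perturb k.+1 s else [::].

Lemma size_perturb k s : size (perturb k s) = size s.
Proof. by elim: s k => //= x s IH k; rewrite IH. Qed.

Lemma perturb_cat k s t :
  perturb k (s ++ t) = perturb k s ++ perturb (k + size s) t.
Proof.
by elim: s k => [|x s IH] k /=; rewrite ?addn0 // IH addSnnS.
Qed.

Lemma horner_perturb k s : map (horner_eval 0) (perturb k s) = s.
Proof.
elim: s k => //= x s IH k; congr (_ :: _); last exact: IH.
by rewrite /horner_eval !hornerE expr0n addr0.
Qed.

Lemma mem_perturb k s a : a \in perturb k s ->
  exists i, a = (s`_i)%:P + 'X^((k + i).+1).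
Proof.
elim: s k => //= x s IH k; rewrite inE => /orP[/eqP->|/IH[i ->]].
  by exists 0; rewrite addn0.
by exists i.+1; rewrite addSnnS.
Qed.

Lemma uniq_perturb k s : uniq (perturb k s).
Proof.
elim: s k => //= x s IH k; rewrite IH andbT; apply/negP => /mem_perturb.
case=> i /(congr1 (fun q : {poly F} => q`_k.+1)).
rewrite !coefE eqxx /= eqSS addSn -addnS -[X in X == _]addn0 eqn_add2l /=.
by rewrite addr0 add0r => /eqP; rewrite oner_eq0.
Qed.

(** Parameter number i alone contains the power i + 1 of ['X], so the coefficient of that power in
    [wb a b] is [l * l']. *)
Lemma generic_perturb (l l' : F) s : l * l' != 0 ->
  generic (tofrac l%:P) (tofrac l'%:P) (map (@tofrac {poly F}) (perturb 0 s)).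
Proof.
move=> p0; split.
  by rewrite map_inj_uniq ?uniq_perturb // => a b /eqP; rewrite tofrac_eq => /eqP.
move=> _ _ /mapP[a ain ->] /mapP[b bin ->]; rewrite tofrac_eq /wb => ab.
rewrite -!tofracM -tofracB tofrac_eq0.
have [i ea] := mem_perturb ain; have [j eb] := mem_perturb bin.
have nij : i != j by apply: contraNneq ab => ij; rewrite ea eb ij.
apply: contraNneq p0 => /(congr1 (fun q : {poly F} => q`_i.+1)).
rewrite ea eb -rmorphM /= coefB coefCM !coefD !coefXn !coefC /= !add0n eqxx.
by rewrite eqSS (negPf nij) !add0r mulr1 subr0 => ->.
Qed.

End Perturbation.

Lemma Z6v_bilinear (F : fieldType) (l l' : F) u1 u2 us v1 v2 vs :
  size us = size vs -> l * l' != 0 ->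
  (u2 - u1) * (v1 - v2) * Z6v l l' [:: u1, u2 & us] [:: v1, v2 & vs]
    * Z6v l l' us vs
  = gw l l' u1 v2 * gw l l' u2 v1
      * Z6v l l' (u2 :: us) (v2 :: vs) * Z6v l l' (u1 :: us) (v1 :: vs)
    - gw l l' u1 v1 * gw l l' u2 v2
      * Z6v l l' (u2 :: us) (v1 :: vs) * Z6v l l' (u1 :: us) (v2 :: vs).
Proof.
move=> szuv p0.
have ev a c : (Z6v l%:P l'%:P a c).[0]
    = Z6v l l' (map (horner_eval 0) a) (map (horner_eval 0) c).
  rewrite -[LHS]/(horner_eval 0 _) rmorph_Z6v /=.
  by congr Z6v; apply: hornerC.
have := generic_perturb ([:: u1, u2 & us] ++ [:: v1, v2 & vs]) p0.
rewrite perturb_cat map_cat /= => gen.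
have := Z6v_bilinear_generic _ gen; rewrite !size_map !size_perturb => /(_ szuv).
rewrite -!map_cons -!rmorph_Z6v /gw /wb -!(tofracM, tofracB) => /eqP.
rewrite tofrac_eq => /eqP/(congr1 (horner_eval 0)).
rewrite /horner_eval !(hornerM, hornerN, hornerD, hornerC, hornerXn).
rewrite !ev /= !horner_perturb /horner_eval.
by rewrite !hornerE !expr0n /= !addr0.
Qed.

(** * Alternating sign matrices as six-vertex states *)

Local Notation ents := [:: 0; 1; -1 : int].

(* A partial sum equal to the bit [b] stays in {0, 1} when [a] is added. *)
Definition follows (b : bool) (a : int) : bool :=
  ((a == 1) ==> ~~ b) && ((a == -1) ==> b).

(** [b] is the sum of the entries already read, kept in {0, 1}; it must end at 1. *)
Fixpoint alt (b : bool) (s : seq int) : bool :=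
  if s is a :: s then follows b a && alt (b (+) (a != 0)) s else b.

(** On an alternating line the partial sums are 0 or 1, hence given by the parity of the number of
    nonzero entries. *)
Definition par (s : seq int) (k : nat) : bool :=
  odd (count (fun a => a != 0) (take k s)).

(** A fictitious entry 1 or -1 in front stands for the current partial sum 1 or 0, so that the
    induction can start anywhere in the word. *)
Lemma alt_path b s : all (mem ents) s ->
  alt b s = path [rel c a | c * a < 0] (if b then 1 else -1) [seq a <- s | a != 0]
            && (b%:Z + \sum_(a <- s) a == 1).
Proof.
elim: s b => [|a s IH] b /=; first by rewrite big_nil; case: b.
rewrite !inE => /andP[ae /IH{}IH]; rewrite big_cons IH.
case/or3P: ae => /eqP->; case: b; rewrite /follows /= ?add0r //.
by rewrite addrA subrr add0r.
Qed.

Lemma alternating_sum1E s : all (mem ents) s -> alternating_sum1 s = alt false s.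
Proof.
move=> se; rewrite alt_path // add0r /alternating_sum1.
have sumf : \sum_(a <- s) a = \sum_(a <- [seq a <- s | a != 0]) a.
  by rewrite big_filter [RHS]big_mkcond; apply: eq_bigr => a _; case: eqP.
have : all (mem [:: 1; -1 : int]) [seq a <- s | a != 0].
  apply/allP => a; rewrite mem_filter => /andP[a0 /(allP se)].
  by rewrite !inE (negPf a0).
rewrite sumf; case: [seq _ <- _ | _] => [|a t] //= at1.
case: (boolP (path _ a t)) => [pt|]; last by rewrite andbF.
rewrite (sum_alternating at1 pt) /= andbT.
by case/andP: at1; rewrite !inE => /orP[]/eqP-> _ //=; case: ifP.
Qed.

Lemma alt_drop b s k : all (mem ents) s -> alt b s ->
  \sum_(a <- drop k s) a = 1 - (b (+) par s k)%:Z.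
Proof.
elim: s b k => [|a s IH] b k /=; first by rewrite /par /= big_nil addbF => _ ->.
move=> /andP[ae se] /andP[ba alts]; case: k => [|k] /=; last first.
  by rewrite (IH _ k se alts) /par /= oddD addbA; case: (a != 0).
have := IH _ 0 se alts; rewrite drop0 big_cons => ->.
rewrite /par !take0 /= !addbF; move: ae ba; rewrite !inE.
by case/or3P=> /eqP->; case: b alts.
Qed.

Lemma alt_follows b s k : alt b s -> (k < size s)%N ->
  follows (b (+) par s k) s`_k.
Proof.
elim: s b k => [|a s IH] b [|k] //= /andP[ba alts] ks; first by rewrite addbF.
by have := IH _ _ alts ks; rewrite /par /= oddD addbA; case: (a != 0).
Qed.

(** * Six-vertex states as words of matrix entries *)

Section Peel.
Variables (R : comNzRingType) (U V : Type) (a0 a1 b d : U -> V -> R).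

Definition entry_wt (u : U) (v : V) (k h : bool) (a : int) : R :=
  if a == 0 then if k then if h then a1 u v else b u v
                 else if h then b u v else a0 u v
  else if a == 1 then 1 else d u v.

Fixpoint column_prod (v : V) (us : seq U) (k : bool) (h : seq bool) (c : seq int) : R :=
  match us, h, c with
  | u :: us, x :: h, a :: c => entry_wt u v k x a * column_prod v us (k (+) (a != 0)) h c
  | _, _, _ => 1
  end.

Definition flip (h : seq bool) (c : seq int) : seq bool :=
  [seq x.1 (+) (x.2 != 0) | x <- zip h c].

Definition column_ok (h : seq bool) (c : seq int) : bool :=
  all (fun x => follows x.1 x.2) (zip h c).

Fixpoint valid (h : seq bool) (C : seq (seq int)) : bool :=
  if C is c :: C then [&& alt false c, column_ok h c & valid (flip h c) C]
  else h == nseq (size h) true.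

Fixpoint total_prod (us : seq U) (vs : seq V) (h : seq bool) (C : seq (seq int)) : R :=
  match vs, C with
  | v :: vs, c :: C => column_prod v us false h c * total_prod us vs (flip h c) C
  | _, _ => 1
  end.

(** An entry is 0 exactly when the horizontal bit passes unchanged, and otherwise that bit fixes its
    sign. So, given the incoming bits, the bits leaving a column and its entries determine each
    other. *)
Lemma column_wt_words v us k h (F : seq bool -> R) : size h = size us ->
  \sum_(c <- words ents (size us))
      (alt k c && column_ok h c)%:R * column_prod v us k h c * F (flip h c)
  = \sum_(g <- bits (size us)) column_wt a0 a1 b d v us k true h g * F g.
Proof.
elim: us k h F => [|u us IH] k [|x h] F //.
  by move=> _; rewrite !big_seq1 /= andbT mulr1; case: k.
case=> szh; rewrite [size (u :: us)]/= big_wordsS big_bitsS.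
have step a : \sum_(w <- words ents (size us))
      (follows k a && alt (k (+) (a != 0)) w && column_ok (x :: h) (a :: w))%:R
      * (entry_wt u v k x a * column_prod v us (k (+) (a != 0)) h w) * F (flip (x :: h) (a :: w))
    = (follows k a && follows x a)%:R * entry_wt u v k x a
      * \sum_(g <- bits (size us)) column_wt a0 a1 b d v us (k (+) (a != 0)) true h g
           * F (x (+) (a != 0) :: g).
  rewrite -(IH _ _ (fun g => F (_ :: g))) // mulr_sumr; apply: eq_bigr => w _.
  rewrite /column_ok /= andbACA -!mulnb !natrM -/(column_ok h w) /flip /= -/(flip h w).
  by ring.
have splitD x1 x2 (c1 c2 G : seq bool -> R) :
    \sum_(g <- bits (size us)) (x1 * c1 g + x2 * c2 g) * G g
    = x1 * (\sum_(g <- bits (size us)) c1 g * G g)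
      + x2 * (\sum_(g <- bits (size us)) c2 g * G g).
  rewrite !mulr_sumr -big_split; apply: eq_bigr => g _ /=.
  by rewrite mulrDl !mulrA.
rewrite !big_cons big_nil !step /= !addbF !addbT.
rewrite (splitD _ _ _ _ (fun g => F (false :: g))).
rewrite (splitD _ _ _ _ (fun g => F (true :: g))) /follows /entry_wt /=.
by case: k {IH step}; case: x => /=; ring.
Qed.

Lemma Zstate_words us vs h : size h = size us ->
  Zstate a0 a1 b d us vs h
    = \sum_(C <- words (words ents (size us)) (size vs))
        (valid h C)%:R * total_prod us vs h C.
Proof.
elim: vs h => [|v vs IH] h szh; first by rewrite big_words0 /= mulr1 szh.
rewrite [size (v :: vs)]/= big_wordsS /=.
rewrite -(column_wt_words _ _ (Zstate a0 a1 b d us vs)) // !big_seq.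
apply: eq_bigr => c; rewrite mem_words => /andP[/eqP szc _].
rewrite IH ?size_map ?size_zip ?szh ?szc ?minnn // mulr_sumr.
by apply: eq_bigr => C _; rewrite andbA -!mulnb !natrM; ring.
Qed.

End Peel.

Lemma nth_flip h c i : size c = size h -> (i < size h)%N ->
  nth false (flip h c) i = nth false h i (+) (c`_i != 0).
Proof.
move=> szc ih; rewrite (nth_map (false, 0)) ?size_zip ?szc ?minnn //.
by rewrite nth_zip.
Qed.

Lemma size_flip h c : size c = size h -> size (flip h c) = size h.
Proof. by move=> szc; rewrite size_map size_zip szc minnn. Qed.

Lemma column_okE h c : size c = size h ->
  column_ok h c = all (fun i => follows (nth false h i) c`_i) (iota 0 (size h)).
Proof.
elim: h c => [|x h IH] [|a c] //= [szc]; rewrite /column_ok /= -/(column_ok h c) IH //.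
by congr (_ && _); rewrite (iotaDl 1 0) all_map.
Qed.

(** The horizontal bits carried through successive columns are the partial sums of the rows. *)
Lemma valid_rows h C : all (fun c => size c == size h) C ->
  valid h C = all (alt false) C
    && all (fun i => alt (nth false h i) [seq c`_i | c <- C]) (iota 0 (size h)).
Proof.
elim: C h => [|c C IH] h /=.
  move=> _; apply/eqP/(all_nthP 0) => [e i|e]; rewrite ?size_iota.
    by move=> ih; rewrite nth_iota // e nth_nseq ih.
  apply: (@eq_from_nth _ false) => [|i ih]; first by rewrite size_nseq.
  by have := e i; rewrite size_iota nth_iota // nth_nseq ih => ->.
case/andP=> /eqP szc szC; rewrite IH size_flip // column_okE //.
rewrite -!andbA; congr (_ && _); rewrite andbCA; congr (_ && _).
rewrite -all_predI; apply: eq_in_all => i; rewrite mem_iota /= => ih.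
by rewrite nth_flip.
Qed.

Section Product.
Variables (R : comNzRingType) (a0 a1 b d : nat -> nat -> R).
Local Notation entry_wt := (entry_wt a0 a1 b d).
Local Notation column_prod := (column_prod a0 a1 b d).
Local Notation total_prod := (total_prod a0 a1 b d).

Lemma column_prodE v m n k h c : size h = n -> size c = n ->
  column_prod v (iota m n) k h c
    = \prod_(i < n) entry_wt (m + i)%N v (k (+) par c i) (nth false h i) c`_i.
Proof.
elim: n m k h c => [|n IH] m k [|x h] [|a c] //=; first by rewrite big_ord0.
move=> [szh] [szc]; rewrite IH // big_ord_recl addn0 /par /= addbF.
congr (_ * _); apply: eq_bigr => i _.
by rewrite /bump /= addSnnS oddD addbA; case: (a != 0).
Qed.

Lemma total_prodE m n q h C : size h = n -> size C = q ->
    all (fun c => size c == n) C ->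
  total_prod (iota 0 n) (iota m q) h C
    = \prod_(j < q) \prod_(i < n)
        entry_wt i (m + j)%N (par (nth [::] C j) i)
          (nth false h i (+) par [seq c`_i | c <- C] j) (nth [::] C j)`_i.
Proof.
move=> szh; elim: q m h szh C => [|q IH] m h szh [|c C] //=.
  by rewrite big_ord0.
case=> szC /andP[/eqP szc szCn]; rewrite big_ord_recl (column_prodE _ 0 _ szh) //.
congr (_ * _).
  by apply: eq_bigr => i _; rewrite addn0 /par /= addbF.
rewrite IH ?size_flip ?szh //; apply: eq_bigr => j _; apply: eq_bigr => i _.
rewrite /bump /= addSnnS nth_flip ?szh //; congr (entry_wt _ _ _ _ _).
by rewrite /par /= oddD addbA; case: (c`_i != 0).
Qed.

End Product.

(** * Partial sums along a row or column *)

Section Lines.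
Variable n : nat.
Implicit Types (f : 'I_n -> int) (j : 'I_n).

Definition line f : seq int := [seq f j | j <- enum 'I_n].
Definition bit f (j : nat) : bool := par (line f) j.

Lemma size_line f : size (line f) = n.
Proof. by rewrite size_map size_enum_ord. Qed.

Lemma nth_line f j : (line f)`_j = f j.
Proof. by rewrite (nth_map j) ?size_enum_ord // nth_ord_enum. Qed.

Definition altline f := {subset line f <= ents} /\ alt false (line f).

Variable f : 'I_n -> int.
Hypothesis f_alt : altline f.

Let fe : all (mem ents) (line f).
Proof. by apply/allP; case: f_alt. Qed.

Lemma line_ents j : f j \in ents.
Proof. by case: f_alt => + _; apply; apply: map_f; rewrite mem_enum. Qed.

Lemma line_follows j : follows (bit f j) (f j).
Proof.
have := @alt_follows false (line f) j f_alt.2.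
by rewrite size_line nth_line; apply.
Qed.

Lemma sum_line_ge k : \sum_(j < n | (k <= j)%N) f j = 1 - (bit f k)%:Z.
Proof. by rewrite suffix_sum_ordE (alt_drop _ fe f_alt.2). Qed.

Lemma sum_line : \sum_j f j = 1.
Proof.
by have := sum_line_ge 0; rewrite /bit /par take0 subr0 => <-; apply: eq_bigl.
Qed.

Lemma bitS j : bit f j.+1 = bit f j (+) (f j != 0).
Proof.
rewrite /bit /par (take_nth 0) ?size_line // nth_line -cats1 count_cat oddD /=.
by case: (f j != 0).
Qed.

Lemma bit0 : bit f 0 = false.
Proof. by rewrite /bit /par take0. Qed.

Lemma bitn : bit f n = true.
Proof.
have := sum_line_ge n; rewrite big_pred0 => [|j]; last by rewrite leqNgt ltn_ord.
by case: (bit f n).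
Qed.

Lemma line_pos j : (forall j, f j != -1) -> (f j == 0) || (f j == 1).
Proof.
by move=> /(_ j) fN; have := line_ents j; rewrite !inE (negPf fN) orbF.
Qed.

Lemma count_zero_line : (forall j, f j != -1) ->
  (\sum_j (f j == 0%R))%N = n.-1.
Proof.
move=> fN.
have one : (\sum_j (f j == 1%R))%N = 1%N.
  apply/eqP; rewrite -eqz_nat -natz natr_sum; apply/eqP; rewrite -[RHS]sum_line.
  by apply: eq_bigr => j _; have /orP[] := line_pos j fN => /eqP->.
have : (\sum_j ((f j == 0%R) + (f j == 1%R)))%N = n.
  rewrite -[RHS]card_ord -sum1_card; apply: eq_bigr => j _.
  by have /orP[] := line_pos j fN => /eqP->.
by rewrite big_split /= one addn1 => /(congr1 predn).
Qed.

(** Without -1 all terms are nonnegative, so a 1 is detected by a sum, which for initial and final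
    segments is a bit. *)
Lemma exists_one (P : pred 'I_n) : (forall j, f j != -1) ->
  [exists k, (f k == 1) && P k] = (\sum_(k | P k) f k != 0).
Proof.
move=> fN; rewrite psumr_eq0 => [|k _]; last first.
  by have /orP[] := line_pos k fN => /eqP->.
rewrite -has_predC; apply/existsP/hasP => [[k /andP[/eqP fk Pk]]|[k _]] /=.
  by exists k; rewrite ?mem_index_enum //= Pk fk.
rewrite negb_imply => /andP[Pk fk]; exists k; rewrite Pk andbT.
by have := line_pos k fN; rewrite (negPf fk).
Qed.

Lemma exists_one_after j : (forall j, f j != -1) -> f j = 0 ->
  [exists k : 'I_n, (f k == 1) && (j < k)%N] = ~~ bit f j.
Proof.
by move=> fN fj; rewrite exists_one // sum_line_ge bitS fj addbF; case: (bit f j).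
Qed.

Lemma exists_one_before j : (forall j, f j != -1) -> f j = 0 ->
  [exists k : 'I_n, (f k == 1) && (k < j)%N] = bit f j.
Proof.
move=> fN fj; rewrite exists_one //; have := sum_line.
rewrite (bigID (fun k : 'I_n => (k < j)%N)) /=.
under [X in _ + X = _ -> _]eq_bigl => k do rewrite -leqNgt.
rewrite sum_line_ge => /eqP; rewrite addrCA addrC -subr_eq0 addrK subr_eq0.
by move/eqP->; case: (bit f j).
Qed.

End Lines.

Section Matrices.
Variable n : nat.
Implicit Type A : 'M[asm_entry]_n.

Definition hbit A (i j : 'I_n) : bool := bit (fun j => asm_mx A i j) j.
Definition vbit A (i j : 'I_n) : bool := bit (fun i => asm_mx A i j) i.
Definition columns A : seq (seq int) :=
  [seq line (fun i => asm_mx A i j) | j <- enum 'I_n].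

Lemma row_sub_ents A i : {subset line (fun j => asm_mx A i j) <= ents}.
Proof. by move=> _ /mapP[j _ ->]; apply: asm_mx_entry. Qed.

Lemma col_sub_ents A j : {subset line (fun i => asm_mx A i j) <= ents}.
Proof. by move=> _ /mapP[i _ ->]; apply: asm_mx_entry. Qed.

Lemma in_ASM A : (A \in ASM n)
  = [forall i, alt false (line (fun j => asm_mx A i j))]
    && [forall j, alt false (line (fun i => asm_mx A i j))].
Proof.
rewrite inE; congr (_ && _); apply: eq_forallb => i;
  by rewrite alternating_sum1E //; apply/allP;
  first [exact: row_sub_ents | exact: col_sub_ents].
Qed.

Lemma ASM_row A i : A \in ASM n -> altline (fun j => asm_mx A i j).
Proof.
by rewrite in_ASM => /andP[/forallP rA _]; split; [apply: row_sub_ents|].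
Qed.

Lemma ASM_col A j : A \in ASM n -> altline (fun i => asm_mx A i j).
Proof.
by rewrite in_ASM => /andP[_ /forallP cA]; split; [apply: col_sub_ents|].
Qed.

Lemma row_columns A (i : 'I_n) :
  [seq c`_i | c <- columns A] = line (fun j => asm_mx A i j).
Proof. by rewrite -map_comp; apply: eq_map => j /=; rewrite nth_line. Qed.

Lemma nth_columns A (j : 'I_n) :
  nth [::] (columns A) j = line (fun i => asm_mx A i j).
Proof. by rewrite (nth_map j) ?size_enum_ord // nth_ord_enum. Qed.

Lemma valid_columns A : valid (nseq n false) (columns A) = (A \in ASM n).
Proof.
rewrite valid_rows; last first.
  by apply/allP => _ /mapP[j _ ->]; rewrite size_line size_nseq.
rewrite in_ASM andbC size_nseq; congr (_ && _).
  apply/allP/forallP => [rA i|rA i].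
    have := rA i; rewrite mem_iota ltn_ord row_columns nth_nseq ltn_ord.
    exact.
  rewrite mem_iota /= => ilt; rewrite nth_nseq ilt.
  by rewrite (row_columns A (Ordinal ilt)); apply: rA.
apply/allP/forallP => [cA j|cA _ /mapP[j _ ->]]; last exact: cA.
by apply: cA; apply: map_f; rewrite mem_enum.
Qed.

Lemma big_columns (R : nmodType) (F : seq (seq int) -> R) :
  \sum_(A : 'M[asm_entry]_n) F (columns A) = \sum_(C <- words (words ents n) n) F C.
Proof.
rewrite -(big_map columns xpredT F); apply: perm_big; apply: uniq_perm.
- rewrite map_inj_uniq ?index_enum_uniq // => A B AB.
  apply/matrixP => i j; apply: val_inj.
  have := congr1 (fun C => (nth [::] C j)`_i) AB.
  by rewrite !nth_columns !nth_line !mxE.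
- by rewrite !uniq_words.
move=> C; rewrite mem_words; apply/mapP/andP => [[A _ ->]|[/eqP szC Ce]].
  rewrite size_map size_enum_ord eqxx; split=> //.
  apply/allP => _ /mapP[j _ ->] /=; rewrite mem_words size_line eqxx.
  by apply/allP; apply: col_sub_ents.
pose e0 : asm_entry := SeqSub (mem_head 0 [:: 1; -1]).
exists (\matrix_(i, j) insubd e0 (nth [::] C j)`_i); first by rewrite mem_index_enum.
apply: (@eq_from_nth _ [::]) => [|j]; first by rewrite size_map size_enum_ord.
rewrite szC => jn; have jC : nth [::] C j \in C by rewrite mem_nth ?szC.
have := allP Ce _ jC; rewrite /= mem_words => /andP[/eqP szc /allP ce].
rewrite (nth_map (Ordinal jn)) ?size_enum_ord //.
apply: (@eq_from_nth _ 0) => [|i]; first by rewrite size_line.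
rewrite szc => ilt; have ic : (nth [::] C j)`_i \in nth [::] C j.
  by rewrite mem_nth ?szc.
rewrite (nth_line _ (Ordinal ilt)) !mxE.
rewrite (nth_ord_enum _ (Ordinal jn)) insubdK //.
exact: ce.
Qed.

Lemma Zdw_ASM (R : comNzRingType) (a0 a1 b d : nat -> nat -> R) :
  Zdw a0 a1 b d (iota 0 n) (iota 0 n)
    = \sum_(A in ASM n) \prod_(i < n) \prod_(j < n)
        entry_wt a0 a1 b d i j (vbit A i j) (hbit A i j) (asm_mx A i j).
Proof.
rewrite /Zdw Zstate_words ?size_nseq // !size_iota -big_columns.
rewrite [RHS]big_mkcond; apply: eq_bigr => A _.
rewrite valid_columns; case: (A \in ASM n); rewrite ?mul0r // mul1r.
rewrite (total_prodE _ _ _ _ _ (n := n)) ?size_nseq //; first last.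
- by apply/allP => _ /mapP[j _ ->]; rewrite size_line.
- by rewrite size_map size_enum_ord.
rewrite exchange_big; apply: eq_bigr => i _; apply: eq_bigr => j _.
rewrite add0n nth_nseq ltn_ord row_columns.
by rewrite nth_columns nth_line.
Qed.

Definition t00 A i j : bool := [&& asm_mx A i j == 0, ~~ vbit A i j & ~~ hbit A i j].

(* [nu] counts the zeros with no 1 pending from the left nor from above. *)
Lemma nuE A : A \in ASM n -> `|nu A|%N = (\sum_i \sum_j t00 A i j)%N.
Proof.
move=> AA; suff -> : nu A = (\sum_i \sum_j t00 A i j)%N by [].
rewrite -natz natr_sum; apply: eq_bigr => i _.
(* Grouped by (i, j'), [nu] sums products of a row sum from j' on and a column sum strictly below i:
   the complements of the horizontal bit entering and the vertical bit leaving (i, j'). *)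
rewrite natr_sum; transitivity (\sum_(j' < n)
    (\sum_(j < n | (j' <= j)%N) asm_mx A i j)
  * (\sum_(i' < n | (i.+1 <= i')%N) asm_mx A i' j')).
  under [RHS]eq_bigr => j' _ do rewrite mulr_sumr.
  rewrite [RHS]exchange_big; apply: eq_bigr => i' _ /=.
  under [RHS]eq_bigr => j' _ do rewrite mulr_suml.
  by rewrite [RHS](exchange_big_dep xpredT).
apply: eq_bigr => j _; rewrite (sum_line_ge (ASM_row i AA)).
rewrite (sum_line_ge (ASM_col j AA)) bitS /t00 /hbit /vbit.
have := line_follows (ASM_row i AA) j; have := line_follows (ASM_col j AA) i.
have := asm_mx_entry A i j; rewrite !inE.
by case/or3P=> /eqP->; case: (bit _ i) => //; case: (bit _ j).
Qed.

Lemma muE A : mu A = (\sum_i \sum_j (asm_mx A i j == -1%R))%N.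
Proof.
rewrite pair_bigA /mu -sum1_card big_mkcond; apply: eq_bigr => p _.
by rewrite inE; case: (_ == _).
Qed.

Lemma hbit_tr A i j : hbit A^T i j = vbit A j i.
Proof. by congr odd; congr count; congr take; apply: eq_map => k; rewrite !mxE. Qed.

Lemma vbit_tr A i j : vbit A^T i j = hbit A j i.
Proof. by rewrite -hbit_tr trmxK. Qed.

Lemma ASM_tr A : (A^T \in ASM n) = (A \in ASM n).
Proof.
rewrite !in_ASM andbC; congr (_ && _); apply: eq_forallb => i; congr alt;
  by apply: eq_map => k; rewrite !mxE.
Qed.

Lemma nu_tr A : A \in ASM n -> `|nu A^T|%N = `|nu A|%N.
Proof.
move=> AA; rewrite !nuE ?ASM_tr // exchange_big; apply: eq_bigr => i _.
apply: eq_bigr => j _; congr nat_of_bool.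
by rewrite /t00 hbit_tr vbit_tr [_ && ~~ hbit _ _ _]andbC !mxE.
Qed.

Lemma mu_tr A : mu A^T = mu A.
Proof.
rewrite !muE exchange_big; apply: eq_bigr => i _; apply: eq_bigr => j _.
by rewrite !mxE.
Qed.

Lemma rhoL_tr A : rhoL A = rhoT A^T.
Proof.
apply: eq_card => j; rewrite !inE; apply: eq_existsb => t; apply: eq_existsb => k.
by rewrite !mxE.
Qed.

(** Transposition preserves [nu] and [mu] and exchanges [rhoT] with [rhoL]. *)
Lemma Zrefined_rhoL (R : comNzRingType) (x y z : R) :
  \sum_(A in ASM n) x ^+ `|nu A|%N * y ^+ mu A * z ^+ rhoL A = Zrefined n x y z.
Proof.
rewrite (reindex_inj (can_inj (@trmxK _ n n))) /=; apply: eq_big => A.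
  by rewrite ASM_tr.
by rewrite ASM_tr => AA; rewrite nu_tr // mu_tr rhoL_tr trmxK.
Qed.

End Matrices.

(** * Boundary statistics *)

Section Boundary.
Variable m : nat.
Variable A : 'M[asm_entry]_(m.+1).
Hypothesis AA : A \in ASM m.+1.

Definition t11 (i j : 'I_m.+1) : bool :=
  [&& asm_mx A i j == 0, vbit A i j & hbit A i j].

Lemma vbit_top j : vbit A 0 j = false.
Proof. exact: bit0. Qed.

Lemma hbit_left i : hbit A i 0 = false.
Proof. exact: bit0. Qed.

Lemma hbit_right i : hbit A i ord_max = (asm_mx A i ord_max == 0).
Proof.
have := bitn (ASM_row i AA); rewrite -[X in bit _ X]/(ord_max : 'I_m.+1).+1 bitS.
by rewrite -/(hbit A i ord_max); case: (hbit _ _ _); case: (_ == _).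
Qed.

Lemma vertex_follows i j :
  follows (vbit A i j) (asm_mx A i j) && follows (hbit A i j) (asm_mx A i j).
Proof.
apply/andP; split; first exact: (line_follows (ASM_col j AA)).
exact: (line_follows (ASM_row i AA)).
Qed.

Lemma top_neqN1 j : asm_mx A 0 j != -1.
Proof.
by have := vertex_follows 0 j; rewrite vbit_top; apply: contraTneq => ->.
Qed.

Lemma left_neqN1 i : asm_mx A i 0 != -1.
Proof.
by have := vertex_follows i 0; rewrite hbit_left andbC; apply: contraTneq => ->.
Qed.

Lemma right_neqN1 i : asm_mx A i ord_max != -1.
Proof.
have := vertex_follows i ord_max; rewrite hbit_right andbC.
by apply: contraTneq => ->.
Qed.

Lemma rhoTE : rhoT A = (\sum_j t00 A 0%R j)%N.
Proof.
rewrite /rhoT -sum1_card big_mkcond; apply: eq_bigr => j _; rewrite inE.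
have -> : [exists t : 'I_m.+1, exists k : 'I_m.+1,
    [&& val t == 0%N, asm_mx A t k == 1, (j < k)%N & asm_mx A t j == 0]]
  = (asm_mx A 0 j == 0) && [exists k : 'I_m.+1, (asm_mx A 0 k == 1) && (j < k)%N].
  apply/existsP/andP => [[t /existsP[k /and4P[/eqP t0 tk jk tj]]]|].
    have -> : 0 = t by apply: val_inj.
    by split=> //; apply/existsP; exists k; rewrite tk.
  case=> j0 /existsP[k /andP[k1 jk]].
  by exists 0; apply/existsP; exists k; rewrite k1 jk j0.
rewrite /t00 vbit_top; case: eqP => //= j0.
rewrite (exists_one_after (ASM_row 0 AA)) //.
exact: top_neqN1.
Qed.

Lemma rhoRE : rhoR A = (\sum_i t11 i ord_max)%N.
Proof.
rewrite /rhoR -sum1_card big_mkcond; apply: eq_bigr => i _; rewrite inE.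
have -> : [exists r : 'I_m.+1, exists k : 'I_m.+1,
    [&& (val r).+1 == m.+1, asm_mx A k r == 1, (k < i)%N & asm_mx A i r == 0]]
  = (asm_mx A i ord_max == 0)
    && [exists k : 'I_m.+1, (asm_mx A k ord_max == 1) && (k < i)%N].
  apply/existsP/andP => [[r /existsP[k /and4P[/eqP[rm] rk ki ri]]]|].
    have -> : ord_max = r by apply: val_inj.
    by split=> //; apply/existsP; exists k; rewrite rk.
  case=> i0 /existsP[k /andP[k1 ki]].
  by exists ord_max; apply/existsP; exists k; rewrite eqxx k1 ki i0.
rewrite /t11 hbit_right; case: eqP => //= i0.
rewrite (exists_one_before (ASM_col ord_max AA)) ?andbT //.
exact: right_neqN1.
Qed.

End Boundary.

Lemma rhoLE m (A : 'M[asm_entry]_(m.+1)) : A \in ASM m.+1 ->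
  rhoL A = (\sum_i t00 A i 0%R)%N.
Proof.
move=> AA; rewrite rhoL_tr rhoTE ?ASM_tr //; apply: eq_bigr => i _.
by rewrite /t00 hbit_tr vbit_tr !mxE [_ && ~~ vbit _ _ _]andbC.
Qed.

(** * Refined generating functions as partition functions *)

Lemma prodrX_sum (R : comNzRingType) (I : finType) (x : R) (F : I -> nat) :
  \prod_i x ^+ F i = x ^+ (\sum_i F i).
Proof. by rewrite (big_morph _ (exprD x) (expr0 x)). Qed.

Lemma prodrX_sum2 (R : comNzRingType) (I J : finType) (x : R) (F : I -> J -> nat) :
  \prod_i \prod_j x ^+ F i j = x ^+ (\sum_i \sum_j F i j).
Proof. by rewrite -prodrX_sum; apply: eq_bigr => i _; apply: prodrX_sum. Qed.

Lemma prodr_pred1 (R : comNzRingType) (I : finType) (k : I) (F : I -> R) :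
  \prod_i (if i == k then F i else 1) = F k.
Proof. by rewrite -big_mkcond big_pred1_eq. Qed.

Lemma prodr_pred1_row (R : comNzRingType) (I J : finType) (k : I) (F : I -> J -> R) :
  \prod_i \prod_j (if i == k then F i j else 1) = \prod_j F k j.
Proof. by rewrite exchange_big; apply: eq_bigr => j _; rewrite prodr_pred1. Qed.

Lemma prodr_pred1_col (R : comNzRingType) (I J : finType) (k : J) (F : I -> J -> R) :
  \prod_i \prod_j (if j == k then F i j else 1) = \prod_i F i k.
Proof. by apply: eq_bigr => i _; rewrite prodr_pred1. Qed.

Section Weights.
Variables (R : comNzRingType) (m : nat) (x y z1 z2 B1 B2 kappa : R).
Variables (a0 a1 b d : nat -> nat -> R).

(* Row 0 and column 0 carry the spectral parameters of the refinement; there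
   are no -1 and no vertices of weight [a1] in them. *)
Lemma Zdw_adj :
    (forall i j, a0 i j = x * (if i == 0%N then z1 * B1 else 1)
                            * (if j == 0%N then z2 * B2 else 1)
                            * (if (i == 0%N) && (j == 0%N) then kappa else 1)) ->
    (forall i j, (i != 0%N) || (j != 0%N) ->
       b i j = (if i == 0%N then B1 else 1) * (if j == 0%N then B2 else 1)) ->
    (forall i j, i != 0%N -> j != 0%N -> a1 i j = 1) ->
    (forall i j, i != 0%N -> j != 0%N -> d i j = y) ->
  Zdw a0 a1 b d (iota 0 m.+1) (iota 0 m.+1)
    = \sum_(A in ASM m.+1) x ^+ `|nu A|%N * y ^+ mu A * z1 ^+ rhoT A * z2 ^+ rhoL A
        * (B1 * B2) ^+ m * kappa ^+ (asm_mx A 0 0 == 0).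
Proof.
move=> a0E bE a1E dE; rewrite Zdw_ASM; apply: eq_bigr => A AA.
(* [B1] and [B2] count all m zeros of their line, while [z1] and [z2] count only its zeros of weight
   [a0]. *)
transitivity (\prod_(i < m.+1) \prod_(j < m.+1)
   (x ^+ t00 A i j * y ^+ (asm_mx A i j == -1)
    * (if i == 0 then z1 ^+ t00 A i j * B1 ^+ (asm_mx A i j == 0) else 1)
    * (if j == 0 then z2 ^+ t00 A i j * B2 ^+ (asm_mx A i j == 0) else 1)
    * (if i == 0 then if j == 0 then kappa ^+ (asm_mx A i j == 0) else 1 else 1))).
  apply: eq_bigr => i _; apply: eq_bigr => j _.
  have := vertex_follows AA i j.
  have hv : i == 0 -> vbit A i j = false by move/eqP->; apply: vbit_top.
  have hh : j == 0 -> hbit A i j = false by move/eqP->; apply: hbit_left.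
  have := a0E i j; have := bE i j; have := a1E i j; have := dE i j; move: hv hh.
  rewrite -[val i == 0%N]/(i == 0) -[val j == 0%N]/(j == 0) /t00 /entry_wt.
  have := asm_mx_entry A i j; rewrite !inE; case/or3P=> /eqP->;
  case: (vbit A i j); case: (hbit A i j); case: (i == 0); case: (j == 0) => /=;
  move=> hv hh dij a1ij bij a0ij;
  first [ by have := hv isT | by have := hh isT | by []
        | by rewrite a0ij => _; ring | by rewrite (bij isT) => _; ring
        | by rewrite (a1ij isT isT) => _; ring
        | by rewrite (dij isT isT) => _; ring | by move=> _; ring].
under eq_bigr => i _ do rewrite !big_split.
rewrite !big_split /= !prodr_pred1_row !prodr_pred1_col prodr_pred1 !big_split.
rewrite !prodrX_sum2 !prodrX_sum nuE // muE rhoTE // rhoLE //.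
rewrite (count_zero_line (ASM_row 0 AA)); last exact: top_neqN1.
rewrite (count_zero_line (ASM_col 0 AA)); last exact: left_neqN1.
rewrite exprMn /= -!mulrA; do 2!congr (_ * _).
by rewrite !mulrA; congr (_ * _); rewrite -!mulrA; congr (_ * _); rewrite mulrCA.
Qed.

End Weights.

(** Every 0 in the last column is entered by a horizontal 1: its weight is [b] above the 1 of that
    column and [a1] below. Hence [z2] sits in [a1], and the corner factor [kappa] in [b]. *)
Lemma Zdw_tilde (R : comNzRingType) (m : nat) (x y z1 z2 B1 B2 kappa : R)
    (a0 a1 b d : nat -> nat -> R) :
    (forall i j, j != m -> a0 i j = x * (if i == 0%N then z1 * B1 else 1)) ->
    (forall i j,
       b i j = (if i == 0%N then B1 else 1) * (if j == m then B2 else 1)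
               * (if (i == 0%N) && (j == m) then kappa else 1)) ->
    (forall i j, i != 0%N -> a1 i j = if j == m then z2 * B2 else 1) ->
    (forall i j, i != 0%N -> j != m -> d i j = y) ->
  Zdw a0 a1 b d (iota 0 m.+1) (iota 0 m.+1)
    = \sum_(A in ASM m.+1) x ^+ `|nu A|%N * y ^+ mu A * z1 ^+ rhoT A * z2 ^+ rhoR A
        * (B1 * B2) ^+ m * kappa ^+ (asm_mx A 0 ord_max == 0).
Proof.
move=> a0E bE a1E dE; rewrite Zdw_ASM; apply: eq_bigr => A AA.
transitivity (\prod_(i < m.+1) \prod_(j < m.+1)
   (x ^+ t00 A i j * y ^+ (asm_mx A i j == -1)
    * (if i == 0 then z1 ^+ t00 A i j * B1 ^+ (asm_mx A i j == 0) else 1)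
    * (if j == ord_max then z2 ^+ t11 A i j * B2 ^+ (asm_mx A i j == 0) else 1)
    * (if i == 0 then
         if j == ord_max then kappa ^+ (asm_mx A i j == 0) else 1 else 1))).
  apply: eq_bigr => i _; apply: eq_bigr => j _.
  have := vertex_follows AA i j.
  have hv : i == 0 -> vbit A i j = false by move/eqP->; apply: vbit_top.
  have hh : j == ord_max -> hbit A i j = (asm_mx A i j == 0).
    by move/eqP->; apply: hbit_right.
  have := a0E i j; have := bE i j; have := a1E i j; have := dE i j; move: hv hh.
  rewrite -[val i == 0%N]/(i == 0) -[val j == m]/(j == ord_max) /t00 /t11 /entry_wt.
  have := asm_mx_entry A i j; rewrite !inE; case/or3P=> /eqP->;
  case: (vbit A i j); case: (hbit A i j); case: (i == 0); case: (j == ord_max) => /=;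
  move=> hv hh dij a1ij bij a0ij;
  first [ by have := hv isT | by have := hh isT | by []
        | by rewrite (a0ij isT) => _; ring | by rewrite bij => _; ring
        | by rewrite (a1ij isT) => _; ring
        | by rewrite (dij isT isT) => _; ring | by move=> _; ring].
under eq_bigr => i _ do rewrite !big_split.
rewrite !big_split /= !prodr_pred1_row !prodr_pred1_col prodr_pred1 !big_split.
rewrite !prodrX_sum2 !prodrX_sum nuE // muE rhoTE // rhoRE //.
rewrite (count_zero_line (ASM_row 0 AA)); last exact: top_neqN1.
rewrite (count_zero_line (ASM_col ord_max AA)); last exact: right_neqN1.
rewrite exprMn /= -!mulrA; do 2!congr (_ * _).
by rewrite !mulrA; congr (_ * _); rewrite -!mulrA; congr (_ * _); rewrite mulrCA.
Qed.

Lemma map_const_in (T : eqType) (U : Type) (s : seq T) (f : T -> U) c :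
  {in s, forall t, f t = c} -> map f s = nseq (size s) c.
Proof. by move/eq_in_map->; elim: s => //= t s ->. Qed.

(** Weights at parameters become weights at positions, the form needed for [Zdw_adj] and
    [Zdw_tilde]. *)
Lemma eq_Zdw_map (R : comNzRingType) (U V U' V' : Type) (fu : U -> U') (fv : V -> V')
    (a0 a1 b d : U' -> V' -> R) us vs :
  Zdw a0 a1 b d (map fu us) (map fv vs)
    = Zdw (fun u v => a0 (fu u) (fv v)) (fun u v => a1 (fu u) (fv v))
         (fun u v => b (fu u) (fv v)) (fun u v => d (fu u) (fv v)) us vs.
Proof.
rewrite /Zdw size_map; apply/esym.
exact: (@rmorph_Zstate R R U V U' V' idfun).
Qed.

Lemma map_head (T : Type) m (u1 u : T) :
  [seq if i == 0%N then u1 else u | i <- iota 0 m.+1] = u1 :: nseq m u.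
Proof.
rewrite /= (@map_const_in _ _ _ _ u) ?size_iota // => t.
by rewrite mem_iota; case: t.
Qed.

Lemma map_last (T : Type) m (v1 v : T) :
  [seq if j == m then v1 else v | j <- iota 0 m.+1] = rcons (nseq m v) v1.
Proof.
rewrite -addn1 iotaD cats1 map_rcons add0n eqxx; congr rcons.
rewrite (@map_const_in _ _ _ _ v) ?size_iota // => t.
by rewrite mem_iota => /andP[_]; rewrite add0n ltn_neqAle => /andP[/negPf->].
Qed.

Section Corner.
Variables (R : comNzRingType) (x y : R).

Definition asm_wt n (z1 z2 : R) (A : 'M[asm_entry]_n) :=
  x ^+ `|nu A|%N * y ^+ mu A * z1 ^+ rhoT A * z2 ^+ rhoL A.

Definition asm_wt_tilde n (z1 z2 : R) (A : 'M[asm_entry]_n) :=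
  x ^+ `|nu A|%N * y ^+ mu A * z1 ^+ rhoT A * z2 ^+ rhoR A.

(** [kappa] compares the special corner weight with the product of its row and column factors; it
    enters exactly when the corner entry is 0. *)
Lemma Zdw_adj_sum (U V : Type) m z1 z2 B1 B2 kappa (u1 u : U) (v1 v : V) a0 a1 b d :
    a0 u v = x -> a1 u v = 1 -> b u v = 1 -> d u v = y ->
    a0 u1 v = x * (z1 * B1) -> b u1 v = B1 ->
    a0 u v1 = x * (z2 * B2) -> b u v1 = B2 ->
    a0 u1 v1 = x * (z1 * B1) * (z2 * B2) * kappa ->
  Zdw a0 a1 b d (u1 :: nseq m u) (v1 :: nseq m v)
    = (B1 * B2) ^+ m * \sum_(A in ASM m.+1)
        asm_wt z1 z2 A * kappa ^+ (asm_mx A 0 0 == 0).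
Proof.
move=> a0uv a1uv buv duv a0u1 bu1 a0v1 bv1 a0uv1.
rewrite -!map_head eq_Zdw_map (@Zdw_adj R m x y z1 z2 B1 B2 kappa) => [||||]; first last.
- by move=> [|i] [|j].
- by move=> [|i] [|j].
- by move=> [|i] [|j] //= _; rewrite ?bu1 ?bv1 ?buv ?mulr1 ?mul1r.
- by move=> [|i] [|j] /=; rewrite ?a0uv ?a0u1 ?a0v1 ?a0uv1 ?mulr1.
rewrite mulr_sumr; apply: eq_bigr => A _.
by rewrite mulrAC mulrC mulrA.
Qed.

Lemma Zdw_Zasm (U V : Type) m (u : U) (v : V) a0 a1 b d :
    a0 u v = x -> a1 u v = 1 -> b u v = 1 -> d u v = y ->
  Zdw a0 a1 b d (nseq m u) (nseq m v) = Zasm m x y.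
Proof.
case: m => [|m] a0uv a1uv buv duv; first by rewrite Zasm0 /Zdw.
rewrite (@Zdw_adj_sum _ _ _ 1 1 1 1 1) ?mulr1 //.
rewrite expr1n mul1r; apply: eq_bigr => A _.
by rewrite /asm_wt !expr1n !mulr1.
Qed.

(** [0 ^+ P A] is the indicator of [P] being false, later of a 1 in the special corner. *)
Lemma sum_corner n (W : 'M[asm_entry]_n -> R) (P : pred 'M[asm_entry]_n) kappa :
  \sum_(A in ASM n) W A * kappa ^+ P A
    = kappa * (\sum_(A in ASM n) W A - \sum_(A in ASM n) W A * 0 ^+ P A)
      + \sum_(A in ASM n) W A * 0 ^+ P A.
Proof.
rewrite -sumrB mulr_sumr -big_split; apply: eq_bigr => A _ /=.
by case: (P A); rewrite ?expr0 ?expr1; ring.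
Qed.

(* Take corner weight 0: only matrices with a 1 in the corner survive, and their
   first row and column are frozen. *)
Lemma Zadj_corner m z1 z2 :
  \sum_(A in ASM m.+1) asm_wt z1 z2 A * 0 ^+ (asm_mx A 0 0 == 0) = Zasm m x y.
Proof.
(* The label [true] marks the special row and the special column. *)
pose a0 (s t : bool) := if s then if t then 0 else x * z1
                        else if t then x * z2 else x.
pose c1 (s t : bool) : R := 1.
have := @Zdw_adj_sum bool bool m z1 z2 1 1 0 true false true false
  a0 c1 c1 (fun _ _ => y).
rewrite !mulr1 mulr0 expr1n mul1r => <- //.
rewrite Zdw_left_corner // !big1 // !mul1r.
exact: Zdw_Zasm.
Qed.

Lemma Zdw_adj_corner (U V : Type) m z1 z2 B1 B2 kappa (u1 u : U) (v1 v : V) a0 a1 b d :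
    a0 u v = x -> a1 u v = 1 -> b u v = 1 -> d u v = y ->
    a0 u1 v = x * (z1 * B1) -> b u1 v = B1 ->
    a0 u v1 = x * (z2 * B2) -> b u v1 = B2 ->
    a0 u1 v1 = x * (z1 * B1) * (z2 * B2) * kappa ->
  Zdw a0 a1 b d (u1 :: nseq m u) (v1 :: nseq m v)
    = (B1 * B2) ^+ m * (kappa * (Zadj m.+1 x y z1 z2 - Zasm m x y) + Zasm m x y).
Proof.
move=> *; rewrite (@Zdw_adj_sum _ _ _ z1 z2 B1 B2 kappa) //.
by rewrite (sum_corner _ (fun A => asm_mx A 0 0 == 0)) Zadj_corner.
Qed.

Lemma Zdw_top (U V : Type) m z B (u1 u : U) (v : V) a0 a1 b d :
    a0 u v = x -> a1 u v = 1 -> b u v = 1 -> d u v = y ->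
    a0 u1 v = x * (z * B) -> b u1 v = B ->
  Zdw a0 a1 b d (u1 :: nseq m u) (nseq m.+1 v) = B ^+ m * Zrefined m.+1 x y z.
Proof.
move=> a0uv a1uv buv duv a0u1 bu1.
rewrite (@Zdw_adj_sum _ _ _ z 1 B 1 1) ?mulr1 //; congr (_ * _).
by apply: eq_bigr => A _; rewrite /asm_wt !expr1n !mulr1.
Qed.

Lemma Zdw_left (U V : Type) m z B (u : U) (v1 v : V) a0 a1 b d :
    a0 u v = x -> a1 u v = 1 -> b u v = 1 -> d u v = y ->
    a0 u v1 = x * (z * B) -> b u v1 = B ->
  Zdw a0 a1 b d (nseq m.+1 u) (v1 :: nseq m v) = B ^+ m * Zrefined m.+1 x y z.
Proof.
move=> a0uv a1uv buv duv a0v1 bv1.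
rewrite (@Zdw_adj_sum _ _ _ 1 z 1 B 1) ?mulr1 ?mul1r //; congr (_ * _).
rewrite -Zrefined_rhoL; apply: eq_bigr => A _.
by rewrite /asm_wt !expr1n !mulr1.
Qed.

Lemma Zdw_tilde_sum (U V : Type) m z1 z2 B1 B2 kappa (u1 u : U) (v1 v : V) a0 a1 b d :
    a0 u v = x -> a1 u v = 1 -> b u v = 1 -> d u v = y ->
    a0 u1 v = x * (z1 * B1) -> b u1 v = B1 ->
    a1 u v1 = z2 * B2 -> b u v1 = B2 -> b u1 v1 = B1 * B2 * kappa ->
  Zdw a0 a1 b d (u1 :: nseq m u) (rcons (nseq m v) v1)
    = (B1 * B2) ^+ m * \sum_(A in ASM m.+1)
        asm_wt_tilde z1 z2 A * kappa ^+ (asm_mx A 0 ord_max == 0).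
Proof.
move=> a0uv a1uv buv duv a0u1 bu1 a1v1 bv1 buv1.
rewrite -map_head -map_last eq_Zdw_map.
rewrite (@Zdw_tilde R m x y z1 z2 B1 B2 kappa) => [||||]; first last.
- by move=> [|i] j //= _ /negPf->.
- by move=> [|i] j //= _; case: eqP.
- by move=> [|i] j /=; case: eqP => _; rewrite ?mulr1 ?mul1r.
- by move=> [|i] j /= /negPf->; rewrite ?mulr1.
rewrite mulr_sumr; apply: eq_bigr => A _.
by rewrite mulrAC mulrC mulrA.
Qed.

Lemma Zadj_tilde_corner m z1 z2 :
  \sum_(A in ASM m.+1) asm_wt_tilde z1 z2 A * 0 ^+ (asm_mx A 0 ord_max == 0)
    = (x * z1 * z2) ^+ m * Zasm m x y.
Proof.
pose a0 (s t : bool) := if s then x * z1 else x.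
pose a1 (s t : bool) := if t then z2 else 1.
pose b (s t : bool) : R := if s && t then 0 else 1.
have := @Zdw_tilde_sum bool bool m z1 z2 1 1 0 true false true false
  a0 a1 b (fun _ _ => y).
rewrite !mulr1 mulr0 expr1n mul1r => <- //.
rewrite /Zdw -[nseq _.+1 _]/(false :: nseq (size (nseq m false)) false).
rewrite Zstate_right_corner ?size_nseq //.
rewrite !big_nseq -!Monoid.iteropE -/(_ ^+ m) -/(_ ^+ m).
rewrite -exprMn_comm; last exact: mulrC.
by rewrite -(@Zdw_Zasm _ _ m false false a0 a1 b (fun _ _ => y)) // /Zdw size_nseq.
Qed.

Lemma Zdw_tilde_corner (U V : Type) m z1 z2 B1 B2 kappa (u1 u : U) (v1 v : V)
    a0 a1 b d :
    a0 u v = x -> a1 u v = 1 -> b u v = 1 -> d u v = y ->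
    a0 u1 v = x * (z1 * B1) -> b u1 v = B1 ->
    a1 u v1 = z2 * B2 -> b u v1 = B2 -> b u1 v1 = B1 * B2 * kappa ->
  Zdw a0 a1 b d (u1 :: nseq m u) (rcons (nseq m v) v1)
    = (B1 * B2) ^+ m
      * (kappa * (Zadj_tilde m.+1 x y z1 z2 - (x * z1 * z2) ^+ m * Zasm m x y)
         + (x * z1 * z2) ^+ m * Zasm m x y).
Proof.
move=> *; rewrite (@Zdw_tilde_sum _ _ _ z1 z2 B1 B2 kappa) //.
by rewrite (sum_corner _ (fun A => asm_mx A 0 ord_max == 0)) Zadj_tilde_corner.
Qed.

End Corner.

(** * Specialisation of the parameters *)

(** Columns commute for generic parameters; distinct powers of ['X] make them generic, and then ['X]
    is set to 0. *)
Lemma Z6v_rcons (F : fieldType) (l l' : F) us v vs : l * l' != 0 ->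
  Z6v l l' us (rcons vs v) = Z6v l l' us (v :: vs).
Proof.
move=> p0.
have ev a c : (Z6v l%:P l'%:P a c).[0]
    = Z6v l l' (map (horner_eval 0) a) (map (horner_eval 0) c).
  rewrite -[LHS]/(horner_eval 0 _) rmorph_Z6v /=.
  by congr Z6v; apply: hornerC.
have evC : map (horner_eval 0) (map polyC us) = us.
  by elim: us => //= u us ->; rewrite /horner_eval hornerC.
pose vs' := perturb 1 vs.
have gw := generic_perturb (v :: vs) p0.
have : Z6v l%:P l'%:P (map polyC us) (rcons vs' (v%:P + 'X^1))
     = Z6v l%:P l'%:P (map polyC us) (v%:P + 'X^1 :: vs').
  apply/eqP; rewrite -tofrac_eq; apply/eqP; rewrite !rmorph_Z6v -cats1 map_cat /=.
  rewrite /Z6v /Zdw Zstate_front ?cats0 // => a /= /mapP[c cin ->].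
  have [/= /andP[vN _] gen] := gw.
  apply: gen; [exact: mem_head | by rewrite inE; apply/orP; right; apply: map_f |].
  by apply: contraNneq vN => ->; apply: map_f.
move/(congr1 (horner_eval 0)); rewrite /horner_eval !ev evC map_rcons /=.
by rewrite /vs' horner_perturb /horner_eval hornerD hornerC hornerXn expr1 addr0.
Qed.

Section Defects.
Variables (R : comNzRingType) (m : nat) (x y z1 z2 : R).

(** Left side minus right side for n = m + 2. Ring morphisms map defects to defects, so their
    vanishing can be moved between rings. *)
Definition adj_defect : R :=
  (z1 - 1) * (z2 - 1) * Zadj m.+2 x y z1 z2 * Zasm m x y
  - (y * z1 * z2 * Zadj m.+1 x y z1 z2 * Zasm m.+1 x y
     + (x * (z1 - 1) * (z2 - 1) - y) * z1 * z2
         * Zrefined m.+1 x y z1 * Zrefined m.+1 x y z2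
     + (z1 - 1) * (z2 - 1) * Zasm m.+1 x y * Zasm m x y).

Definition tilde_defect : R :=
  (z1 - 1) * (z2 - 1) * Zadj_tilde m.+2 x y z1 z2 * Zasm m x y
  - (y * z1 * z2 * Zadj_tilde m.+1 x y z1 z2 * Zasm m.+1 x y
     + ((z1 - 1) * (z2 - 1) - y * z1 * z2)
         * Zrefined m.+1 x y z1 * Zrefined m.+1 x y z2
     + (z1 - 1) * (z2 - 1) * (x * z1 * z2) ^+ m.+1
         * Zasm m.+1 x y * Zasm m x y).

End Defects.

Section Specialisation.
Variables (F : fieldType) (x y z1 z2 L : F).
Hypotheses (x0 : x != 0) (L0 : L != 0) (z10 : z1 != 0) (z20 : z2 != 0).
Hypotheses (xL1 : 1 - x * L != 0) (L1 : L - 1 != 0) (p1 : x * L * L - 1 != 0).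
Hypotheses (xz1L : 1 - x * z1 * L != 0) (Lz2 : L - z2 != 0).
Hypothesis yE : y = (1 - x * L) * (L - 1) / L.

(* [u] and [v] make the weights [x, 1, 1, y] with [l = x * L] and [l' = L]; then
   [u1] and [v1] multiply the ratio of [a0] to [b] by [z1] and [z2]. *)
Let u := (L - 1) / (L * (x * L * L - 1)).
Let v := (1 - x * L) / (x * L * L - 1).
Let u1 := v * (L - z1) / (L * (1 - x * z1 * L)).
Let v1 := u * L * (1 - x * z2 * L) / (L - z2).
Let B1 := (1 - x * L) / (1 - x * z1 * L).
Let B2 := (L - 1) / (L - z2).

Let a0uv : wa0 (x * L) u v = x.
Proof. by rewrite /wa0 /u /v; field; rewrite ?L0 ?p1. Qed.
Let a1uv : wa1 L u v = 1.
Proof. by rewrite /wa1 /u /v; field; rewrite ?L0 ?p1. Qed.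
Let buv : wb (x * L) L u v = 1.
Proof. by rewrite /wb /u /v; field; rewrite ?L0 ?p1. Qed.
Let duv : wd (x * L) L u v = y.
Proof. by rewrite /wd yE /u /v; field; rewrite ?L0 ?p1. Qed.
Let a0u1 : wa0 (x * L) u1 v = x * (z1 * B1).
Proof. by rewrite /wa0 /u1 /v /B1; field; rewrite ?L0 ?p1 ?xz1L. Qed.
Let bu1 : wb (x * L) L u1 v = B1.
Proof. by rewrite /wb /u1 /v /B1; field; rewrite ?L0 ?p1 ?xz1L. Qed.
Let a0v1 : wa0 (x * L) u v1 = x * (z2 * B2).
Proof. by rewrite /wa0 /v1 /u /B2; field; rewrite ?L0 ?p1 ?Lz2. Qed.
Let a1v1 : wa1 L u v1 = z2 * B2.
Proof. by rewrite /wa1 /v1 /u /B2; field; rewrite ?L0 ?p1 ?Lz2. Qed.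
Let bv1 : wb (x * L) L u v1 = B2.
Proof. by rewrite /wb /v1 /u /B2; field; rewrite ?L0 ?p1 ?Lz2. Qed.

Let B10 : B1 != 0. Proof. by rewrite mulf_neq0 ?invr_eq0. Qed.
Let B20 : B2 != 0. Proof. by rewrite mulf_neq0 ?invr_eq0. Qed.

(* Up to units, [(1 - x * L) * P1 - P2] is [u1 - v1] and
   [x * L * L * (1 - x * L) * P1 - P2] is [wb u1 v1]. *)
Let P1 := (L - z1) * (L - z2).
Let P2 := L * (L - 1) * (1 - x * z2 * L) * (1 - x * z1 * L).

Let homE m : Z6v (x * L) L (nseq m u) (nseq m v) = Zasm m x y.
Proof. exact: Zdw_Zasm. Qed.

Let topE m :
  Z6v (x * L) L (u1 :: nseq m u) (nseq m.+1 v) = B1 ^+ m * Zrefined m.+1 x y z1.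
Proof. exact: Zdw_top. Qed.

Let leftE m :
  Z6v (x * L) L (nseq m.+1 u) (v1 :: nseq m v) = B2 ^+ m * Zrefined m.+1 x y z2.
Proof. exact: Zdw_left. Qed.

(** With all parameters but u1 and v1 homogeneous, four of the six partition functions in
    [Z6v_bilinear] are [Zasm] or [Zrefined] up to powers of [B1] and [B2]. *)
Let bilinear m :
  (u - u1) * (v1 - v) * Z6v (x * L) L (u1 :: nseq m.+1 u) (v1 :: nseq m.+1 v)
    * Zasm m x y
  = (u1 - v) * B1 * ((u - v1) * B2)
      * Zasm m.+1 x y * Z6v (x * L) L (u1 :: nseq m u) (v1 :: nseq m v)
    - (u1 - v1) * wb (x * L) L u1 v1 * (u - v)
      * (B2 ^+ m * Zrefined m.+1 x y z2) * (B1 ^+ m * Zrefined m.+1 x y z1).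
Proof.
have p0 : x * L * L != 0 by rewrite !mulf_neq0.
have := @Z6v_bilinear F (x * L) L u1 u (nseq m u) v1 v (nseq m v).
rewrite !size_nseq homE => /(_ erefl p0) ->.
rewrite -[u :: nseq m u]/(nseq m.+1 u) -[v :: nseq m v]/(nseq m.+1 v).
by rewrite homE leftE topE /gw bu1 bv1 buv mulr1.
Qed.

Lemma adj_defect_eq0 m : (1 - x * L) * P1 - P2 != 0 -> adj_defect m x y z1 z2 = 0.
Proof.
(* The value of [kappa]: the actual weight [a0] at (u1, v1) over its factorised value. *)
move=> N0; pose k := x * L * (u1 - v1) / (x * z1 * z2 * B1 * B2).
have adjE m' : Z6v (x * L) L (u1 :: nseq m' u) (v1 :: nseq m' v)
    = (B1 * B2) ^+ m' * (k * (Zadj m'.+1 x y z1 z2 - Zasm m' x y) + Zasm m' x y).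
  apply: Zdw_adj_corner => //; rewrite /wa0 /k.
  by field; rewrite x0 z10 z20 B10 B20.
have := bilinear m; rewrite !adjE exprS exprMn.
have := expf_neq0 m B10; have := expf_neq0 m B20.
rewrite /adj_defect.
move: (B1 ^+ m) (B2 ^+ m) (Zadj m.+2 _ _ _ _) (Zadj m.+1 _ _ _ _)
  (Zasm m.+1 _ _) (Zasm m _ _) (Zrefined _ _ _ z1) (Zrefined _ _ _ z2).
move=> b1 b2 Z1 Z2 Z3 Z4 R1 R2 b20 b10 /eqP; rewrite -subr_eq0 => /eqP E.
apply: (mulfI N0); rewrite mulr0.
(* All terms of the bilinear identity are divisible by u1 - v1; [c] clears denominators and leaves
   (1 - x L) P1 - P2 as cofactor of the defect. *)
pose c := L * (x * L * L - 1) * (1 - x * z1 * L) * (L - z2)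
  * (z1 * z2 * (1 - x * z1 * L) * (L - z2)) / (b1 * b2).
rewrite -[RHS](mulr0 c) -[in RHS]E /c /k /wb /B1 /B2 /u1 /v1 /u /v yE /P1 /P2.
by field; rewrite p1 L0 Lz2 xz1L L1 xL1 z20 z10 x0 b20.
Qed.

Lemma tilde_defect_eq0 m :
  x * L * L * (1 - x * L) * P1 - P2 != 0 -> tilde_defect m x y z1 z2 = 0.
Proof.
(* A 0 in the top right corner has weight [wb] instead of [wa0], so the common factor is now [wb] at
   (u1, v1). *)
move=> N0; pose k := wb (x * L) L u1 v1 / (B1 * B2).
have p0 : x * L * L != 0 by rewrite !mulf_neq0.
have tildeE m' : Z6v (x * L) L (u1 :: nseq m' u) (v1 :: nseq m' v)
    = (B1 * B2) ^+ m' * (k * (Zadj_tilde m'.+1 x y z1 z2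
           - (x * z1 * z2) ^+ m' * Zasm m' x y) + (x * z1 * z2) ^+ m' * Zasm m' x y).
  rewrite -Z6v_rcons //; apply: Zdw_tilde_corner => //.
  by rewrite /k [RHS]mulrC (divfK (mulf_neq0 B10 B20)).
have := bilinear m; rewrite !tildeE !(exprS _ m) [(B1 * B2) ^+ m]exprMn.
have := expf_neq0 m B10; have := expf_neq0 m B20.
rewrite /tilde_defect exprS.
move: (B1 ^+ m) (B2 ^+ m) ((_ * z2) ^+ m)
  (Zadj_tilde m.+2 _ _ _ _) (Zadj_tilde m.+1 _ _ _ _)
  (Zasm m.+1 _ _) (Zasm m _ _) (Zrefined _ _ _ z1) (Zrefined _ _ _ z2).
move=> b1 b2 t Z1 Z2 Z3 Z4 R1 R2 b20 b10 /eqP; rewrite -subr_eq0 => /eqP E.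
apply: (mulfI N0); rewrite mulr0.
pose c := L ^+ 2 * (x * L * L - 1) * (1 - x * z1 * L) ^+ 2 * (L - z2) ^+ 2
  / (b1 * b2).
rewrite -[RHS](mulr0 c) -[in RHS]E /c /k /wb /B1 /B2 /u1 /v1 /u /v yE /P1 /P2.
by field; rewrite p1 L0 Lz2 xz1L L1 xL1 b20.
Qed.

End Specialisation.

(** * Passage from special parameters to indeterminates *)

Section RMorphisms.
Variables (R S : comNzRingType) (f : {rmorphism R -> S}).

Lemma rmorph_Zadj n x y z1 z2 :
  f (Zadj n x y z1 z2) = Zadj n (f x) (f y) (f z1) (f z2).
Proof. by rewrite rmorph_sum; apply: eq_bigr => A _; rewrite !rmorphM !rmorphXn. Qed.

Lemma rmorph_Zadj_tilde n x y z1 z2 :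
  f (Zadj_tilde n x y z1 z2) = Zadj_tilde n (f x) (f y) (f z1) (f z2).
Proof. by rewrite rmorph_sum; apply: eq_bigr => A _; rewrite !rmorphM !rmorphXn. Qed.

Lemma rmorph_Zrefined n x y z : f (Zrefined n x y z) = Zrefined n (f x) (f y) (f z).
Proof. by rewrite rmorph_sum; apply: eq_bigr => A _; rewrite !rmorphM !rmorphXn. Qed.

Lemma rmorph_Zasm n x y : f (Zasm n x y) = Zasm n (f x) (f y).
Proof. by rewrite rmorph_sum; apply: eq_bigr => A _; rewrite !rmorphM !rmorphXn. Qed.

Lemma rmorph_adj_defect m x y z1 z2 :
  f (adj_defect m x y z1 z2) = adj_defect m (f x) (f y) (f z1) (f z2).
Proof.
rewrite /adj_defect -!rmorph_Zadj -!rmorph_Zasm -!rmorph_Zrefined.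
by rewrite !(rmorphB f, rmorphD f, rmorphM f, rmorph1 f).
Qed.

Lemma rmorph_tilde_defect m x y z1 z2 :
  f (tilde_defect m x y z1 z2) = tilde_defect m (f x) (f y) (f z1) (f z2).
Proof.
rewrite /tilde_defect -!rmorph_Zadj_tilde -!rmorph_Zasm -!rmorph_Zrefined.
by rewrite !(rmorphB f, rmorphD f, rmorphM f, rmorph1 f, rmorphXn f).
Qed.

End RMorphisms.

Lemma defects_param (C : fieldType) (x L : C) m (z1 z2 : C) :
    x != 0 -> L != 0 -> 1 - x * L != 0 -> L - 1 != 0 -> x * L * L - 1 != 0 ->
  let y := (1 - x * L) * (L - 1) / L in
  adj_defect m x y z1 z2 = 0 /\ tilde_defect m x y z1 z2 = 0.
Proof.
move=> x0 L0 xL1 L1 p1 y.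
(* Work with indeterminates [Y1] and [Y2] for [z1] and [z2]; all denominators
   are nonzero at [Y1 = L] and [Y2 = 0]. *)
pose cst (c : C) : {poly {poly C}} := c%:P%:P.
pose tf (q : {poly {poly C}}) : {fraction {poly {poly C}}} := tofrac q.
pose Y1 : {poly {poly C}} := 'X%:P; pose Y2 : {poly {poly C}} := 'X.
have nz (q : {poly {poly C}}) : q.[0].[L] != 0 -> tf q != 0.
  by rewrite tofrac_eq0; apply: contraNneq => ->; rewrite !horner0.
have cB a b : cst (a - b) = cst a - cst b by rewrite /cst !rmorphB.
have cM a b : cst (a * b) = cst a * cst b by rewrite /cst !rmorphM.
have c1 : cst 1 = 1 by rewrite /cst !rmorph1.
have tB a b : tf (a - b) = tf a - tf b by rewrite /tf rmorphB.
have tM a b : tf (a * b) = tf a * tf b by rewrite /tf rmorphM.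
have t1 : tf 1 = 1 by rewrite /tf rmorph1.
have n0 : tf (cst x) != 0 by apply: nz; rewrite !hornerC.
have n1 : tf (cst L) != 0 by apply: nz; rewrite !hornerC.
have n2 : tf Y1 != 0 by apply: nz; rewrite hornerC hornerX.
have n3 : tf Y2 != 0 by rewrite tofrac_eq0 polyX_eq0.
have n4 : 1 - tf (cst x) * tf (cst L) != 0.
  have : tf (1 - cst x * cst L) != 0.
    by apply: nz; rewrite /cst /Y1 /Y2 !(hornerD, hornerN, hornerM, hornerC, hornerX).
  by rewrite tB tM t1.
have n5 : tf (cst L) - 1 != 0.
  have : tf (cst L - 1) != 0.
    by apply: nz; rewrite /cst /Y1 /Y2 !(hornerD, hornerN, hornerM, hornerC, hornerX).
  by rewrite tB t1.
have n6 : tf (cst x) * tf (cst L) * tf (cst L) - 1 != 0.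
  have : tf (cst x * cst L * cst L - 1) != 0.
    by apply: nz; rewrite /cst /Y1 /Y2 !(hornerD, hornerN, hornerM, hornerC, hornerX).
  by rewrite tB !tM t1.
have n7 : 1 - tf (cst x) * tf Y1 * tf (cst L) != 0.
  have : tf (1 - cst x * Y1 * cst L) != 0.
    apply: nz; rewrite /cst /Y1 /Y2 !(hornerD, hornerN, hornerM, hornerC, hornerX).
    by rewrite -opprB oppr_eq0.
  by rewrite tB !tM t1.
have n8 : tf (cst L) - tf Y2 != 0.
  have : tf (cst L - Y2) != 0.
    apply: nz; rewrite /cst /Y1 /Y2 !(hornerD, hornerN, hornerM, hornerC, hornerX).
    by rewrite subr0.
  by rewrite tB.
have tfE (q r s t w : {poly {poly C}}) :
    tf (q * (1 - r * s) * ((s - t) * (s - w))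
        - s * (s - 1) * (1 - r * w * s) * (1 - r * t * s))
    = tf q * (1 - tf r * tf s) * ((tf s - tf t) * (tf s - tf w))
      - tf s * (tf s - 1) * (1 - tf r * tf w * tf s) * (1 - tf r * tf t * tf s).
  by rewrite !(tB, tM, t1).
have tM3 (q r s : {poly {poly C}}) : tf (q * r * s) = tf q * tf r * tf s.
  by rewrite !tM.
(* The choice q = 1 serves the first recursion, q = x L^2 the second. At [Y1] = L and [Y2] = 0 the
   first product vanishes and -L (L - 1) (1 - x L^2) remains. *)
have nzN q : tf q * (1 - tf (cst x) * tf (cst L))
      * ((tf (cst L) - tf Y1) * (tf (cst L) - tf Y2))
    - tf (cst L) * (tf (cst L) - 1) * (1 - tf (cst x) * tf Y2 * tf (cst L))
      * (1 - tf (cst x) * tf Y1 * tf (cst L)) != 0.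
  rewrite -tfE.
  apply: nz; rewrite /cst /Y1 /Y2 !(hornerD, hornerN, hornerM, hornerC, hornerX).
  rewrite subrr mul0r mulr0 sub0r oppr_eq0 mulr0 mul0r subr0 mulr1.
  by rewrite -(opprB (x * L * L)) mulrN oppr_eq0 !mulf_neq0.
have yE : tf (cst y) = (1 - tf (cst x) * tf (cst L)) * (tf (cst L) - 1) / tf (cst L).
  apply: (canRL (mulfK n1)).
  by rewrite -t1 -c1 -!(tM, tB) -!(cM, cB) divfK.
have to0 (q : {poly {poly C}}) : tf q = 0 -> q.[z2%:P].[z1] = 0.
  by move/eqP; rewrite tofrac_eq0 => /eqP->; rewrite !horner0.
have cstE c : horner_eval z1 (horner_eval z2%:P (cst c)) = c.
  by rewrite /horner_eval /cst !hornerC.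
have Y1E : horner_eval z1 (horner_eval z2%:P Y1) = z1.
  by rewrite /horner_eval /Y1 hornerC hornerX.
have Y2E : horner_eval z1 (horner_eval z2%:P Y2) = z2.
  by rewrite /horner_eval /Y2 hornerX hornerC.
split.
  have : tf (adj_defect m (cst x) (cst y) Y1 Y2) = 0.
    apply: etrans (rmorph_adj_defect (@tofrac _) m (cst x) (cst y) Y1 Y2) _.
    apply: (adj_defect_eq0 n0 n1 n2 n3 n4 n5 n6 n7 n8 yE).
    by have := nzN 1; rewrite t1 mul1r.
  move/to0; rewrite -[LHS]/(horner_eval z1 (horner_eval z2%:P _)).
  by rewrite !rmorph_adj_defect /= cstE cstE Y1E Y2E.
have : tf (tilde_defect m (cst x) (cst y) Y1 Y2) = 0.
  apply: etrans (rmorph_tilde_defect (@tofrac _) m (cst x) (cst y) Y1 Y2) _.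
  apply: (tilde_defect_eq0 n0 n1 n4 n5 n6 n7 n8 yE).
  have nzq := nzN (cst x * cst L * cst L).
  rewrite (tM3 (cst x) (cst L)) in nzq.
  exact: nzq.
move/to0; rewrite -[LHS]/(horner_eval z1 (horner_eval z2%:P _)).
by rewrite !rmorph_tilde_defect /= cstE cstE Y1E Y2E.
Qed.

(** The L needed is a root of x L^2 + (y - 1 - x) L + 1. That y is nonzero excludes L = 1 and x L =
    1; a nonzero discriminant excludes x L^2 = 1, where the root would be double. *)
Lemma defects_algC (x y z1 z2 : algC) m :
    x != 0 -> y != 0 -> (1 + x - y) ^+ 2 != 4%:R * x ->
  adj_defect m x y z1 z2 = 0 /\ tilde_defect m x y z1 z2 = 0.
Proof.
move=> x0 y0 disc.
have [L Lroot] : exists L, x * L ^+ 2 + (y - 1 - x) * L + 1 = 0.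
  have szp : size (x%:P * 'X^2 + (y - 1 - x)%:P * 'X + 1) != 1%N.
    rewrite -addrA size_polyDl size_Cmul // size_polyXn //.
    rewrite (leq_ltn_trans (size_polyD _ _)) // gtn_max size_poly1 andbT.
    rewrite mul_polyC (leq_ltn_trans (size_scale_leq _ _)) //.
    by rewrite size_polyX.
  have [L] := closed_rootP _ szp.
  rewrite rootE !(hornerD, hornerM, hornerXn, hornerC, hornerX).
  by move/eqP; exists L.
have L0 : L != 0.
  by apply: contra_eqN Lroot => /eqP->; rewrite expr0n !mulr0 !add0r oner_eq0.
have yE : y = (1 - x * L) * (L - 1) / L.
  apply: (canRL (mulfK L0)); apply/eqP; rewrite -subr_eq0 -Lroot; apply/eqP; ring.
rewrite yE; apply: defects_param => //.
- by apply: contraNneq y0; rewrite yE => ->; rewrite !mul0r.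
- by apply: contraNneq y0; rewrite yE => ->; rewrite mulr0 mul0r.
apply: contraNneq disc => /eqP; rewrite subr_eq0 => /eqP p1.
apply/eqP; apply: (mulfI (expf_neq0 2 L0)).
have e : (1 + x - y) * L = 2.
  have -> : (1 + x - y) * L = x * L * L + 1 - (x * L ^+ 2 + (y - 1 - x) * L + 1).
    by ring.
  by rewrite Lroot p1 subr0.
transitivity (((1 + x - y) * L) ^+ 2); first by ring.
rewrite e; transitivity (4%:R * (x * L * L)); last by ring.
by rewrite p1; ring.
Qed.

(** * Integer polynomials vanishing at all integer points *)

Lemma poly_int_eq0 (r : {poly int}) : (forall k : nat, r.[k%:Z] = 0) -> r = 0.
Proof.
move=> r0; apply: (@roots_geq_poly_eq0 _ _ [seq k%:Z | k <- iota 0 (size r)]).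
- by apply/allP => _ /mapP[k _ ->]; rewrite rootE r0.
- by rewrite map_inj_uniq ?iota_uniq // => i j [].
- by rewrite size_map size_iota.
Qed.

Local Notation widen n := (widen_ord (leqnSn n)).

Lemma mnm_eq_widen n (m m' : 'X_{1..n.+1}) :
  (m' == m) = (m ord_max == m' ord_max)
    && ([multinom m' (widen n i) | i < n] == [multinom m (widen n i) | i < n]).
Proof.
apply/eqP/andP => [->|[/eqP mm /eqP mw]]; first by rewrite !eqxx.
apply/mnmP => i; case: (unliftP ord_max i) => [j ->|->]; last by rewrite mm.
have -> : lift ord_max j = widen n j.
  by apply: val_inj; rewrite /= /bump leqNgt ltn_ord.
by have := congr1 (fun t : 'X_{1..n} => t j) mw; rewrite !mnmE.
Qed.

Lemma coef_muni n (R : comNzRingType) (p : {mpoly R[n.+1]}) (m : 'X_{1..n.+1}) :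
  (muni p)`_(m ord_max)@_[multinom m (widen n i) | i < n] = p@_m.
Proof.
rewrite muniE coef_sum raddf_sum /= [RHS](congr1 (mcoeff m) (mpolyE p)) raddf_sum /=.
apply: eq_bigr => m' _; rewrite coefZ coefXn !mcoeffZ mcoeffX mnm_eq_widen.
case: eqP => _ /=; last by rewrite mulr0 mcoeff0 mulr0.
by rewrite mulr1 mcoeffZ mcoeffX.
Qed.

Lemma meval_muni n (R : comNzRingType) (p : {mpoly R[n.+1]}) (v : 'I_n.+1 -> R) :
  p.@[v] = (map_poly (meval (v \o widen n)) (muni p)).[v ord_max].
Proof.
rewrite muniE rmorph_sum horner_sum mevalE; apply: eq_bigr => m _ /=.
rewrite map_polyZ map_polyXn hornerZ hornerXn /= mevalZ mevalX big_ord_recr /=.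
by rewrite mulrA; congr (_ * _ * _); apply: eq_bigr => i _; rewrite mnmE.
Qed.

(** Fixing all variables but the last leaves a univariate polynomial with infinitely many zeros. So
    each coefficient of [muni p] vanishes at all integer points, and the induction applies to it. *)
Lemma meval_int_eq0 n (p : {mpoly int[n]}) : (forall v, p.@[v] = 0) -> p = 0.
Proof.
elim: n p => [|n IH] p p0.
  apply/mpolyP => m; rewrite mcoeff0 -(p0 (fun=> 0)) mevalE.
  have m0 (m' : 'X_{1..0}) : m' = m by apply/mnmP => -[].
  case: (boolP (m \in msupp p)) => [mp|/[dup] mp /memN_msupp_eq0->].
    rewrite (bigD1_seq m) ?msupp_uniq //= big_ord0 mulr1 big1 ?addr0 //.
    by move=> m' /eqP; rewrite (m0 m').
  by rewrite big_seq big1 // => m'; rewrite (m0 m') (negPf mp).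
have q0 k : (muni p)`_k = 0.
  apply: IH => v; pose w (t : int) (i : 'I_n.+1) :=
    if unlift ord_max i is Some j then v j else t.
  suff : map_poly (meval v) (muni p) = 0.
    by move/(congr1 (fun q : {poly int} => q`_k)); rewrite coef_map coef0.
  apply: poly_int_eq0 => t; rewrite -[RHS](p0 (w t%:Z)) meval_muni.
  have wE : w t%:Z \o widen n =1 v.
    move=> i /=; rewrite /w; have -> : widen n i = lift ord_max i.
      by apply: val_inj; rewrite /= /bump leqNgt ltn_ord.
    by rewrite liftK.
  rewrite {2}/w unlift_none; congr horner.
  by apply/polyP => i; rewrite !coef_map /=; apply/esym/meval_eq.
by apply/mpolyP => m; rewrite -coef_muni q0 !mcoeff0.
Qed.

(** The excluded points are the zeros of the nonzero polynomial [D], so [D * P] vanishes at all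
    integer points, and [D] cancels. *)
Lemma defects_mpoly (P : {mpoly int[4]}) (g : algC -> algC -> algC -> algC -> algC) :
    (forall v : 'I_4 -> int,
       (P.@[v])%:~R = g (v 0)%:~R (v 1)%:~R (v 2%:R)%:~R (v 3%:R)%:~R) ->
    (forall x y z1 z2, x != 0 -> y != 0 -> (1 + x - y) ^+ 2 != 4%:R * x ->
       g x y z1 z2 = 0) ->
  P = 0.
Proof.
move=> Pg g0; pose D : {mpoly int[4]} :=
  'X_0 * 'X_1 * ((1 + 'X_0 - 'X_1) ^+ 2 - 4%:R * 'X_0).
have DE v : D.@[v] = v 0 * v 1 * ((1 + v 0 - v 1) ^+ 2 - 4%:R * v 0).
  by rewrite !(mevalM, mevalB, mevalD, mevalXU, meval1).
have D0 : D != 0.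
  (* With all variables equal to 1, [D] takes the value -3. *)
  by apply/eqP => /(congr1 (meval (fun=> 1))); rewrite DE meval0.
apply: (mulfI D0); rewrite mulr0; apply: meval_int_eq0 => v.
rewrite mevalM; apply/eqP; rewrite mulf_eq0; case: (boolP (_ == 0)) => //= Dv.
rewrite -(intr_eq0 algC) Pg g0 //.
- by move: Dv; rewrite DE intr_eq0; apply: contraNneq => ->; rewrite !mul0r.
- by move: Dv; rewrite DE intr_eq0; apply: contraNneq => ->; rewrite mulr0 mul0r.
move: Dv; rewrite DE; apply: contraNN => e.
suff /eqP-> : (1 + v 0 - v 1) ^+ 2 - 4%:R * v 0 == 0 by rewrite mulr0.
by rewrite -(intr_eq0 algC) !(rmorphB, rmorphD, rmorphM, rmorphXn, rmorph1) subr_eq0.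
Qed.

Lemma mpoly_defects_eq0 m :
  adj_defect m ('X_0 : {mpoly int[4]}) 'X_1 'X_2 'X_3 = 0
  /\ tilde_defect m ('X_0 : {mpoly int[4]}) 'X_1 'X_2 'X_3 = 0.
Proof.
split.
  apply: (@defects_mpoly _ (adj_defect m)) => [v|x y z1 z2 *].
    by rewrite rmorph_adj_defect (rmorph_adj_defect intr) /= !mevalXU.
  by have [] := @defects_algC x y z1 z2 m.
apply: (@defects_mpoly _ (tilde_defect m)) => [v|x y z1 z2 *].
  by rewrite rmorph_tilde_defect (rmorph_tilde_defect intr) /= !mevalXU.
by have [] := @defects_algC x y z1 z2 m.
Qed.

Theorem corollary3 (n : nat) (hn : (2 <= n)%N) :
  let x : {mpoly int[4]} := 'X_0 in
  let y : {mpoly int[4]} := 'X_1 in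
  let z1 : {mpoly int[4]} := 'X_2 in
  let z2 : {mpoly int[4]} := 'X_3 in
  (z1 - 1) * (z2 - 1) * Zadj n x y z1 z2 * Zasm (n - 2) x y
    = y * z1 * z2 * Zadj (n - 1) x y z1 z2 * Zasm (n - 1) x y
      + (x * (z1 - 1) * (z2 - 1) - y) * z1 * z2
          * Zrefined (n - 1) x y z1 * Zrefined (n - 1) x y z2
      + (z1 - 1) * (z2 - 1) * Zasm (n - 1) x y * Zasm (n - 2) x y
  /\
  (z1 - 1) * (z2 - 1) * Zadj_tilde n x y z1 z2 * Zasm (n - 2) x y
    = y * z1 * z2 * Zadj_tilde (n - 1) x y z1 z2 * Zasm (n - 1) x y
      + ((z1 - 1) * (z2 - 1) - y * z1 * z2)
          * Zrefined (n - 1) x y z1 * Zrefined (n - 1) x y z2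
      + (z1 - 1) * (z2 - 1) * (x * z1 * z2) ^+ (n - 1)
          * Zasm (n - 1) x y * Zasm (n - 2) x y.
Proof.
case: n hn => [|[|m]] // _ x y z1 z2; rewrite !subSS !subn0.
have [adj0 tilde0] := mpoly_defects_eq0 m.
by split; apply/eqP; rewrite -subr_eq0; apply/eqP.
Qed.
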